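(* Consider a bicycling geodesic in $\mathbb{R}^3$ with non-linear front track $\mathbf{x}(t)$, parametrized by arc length with $t=0$ at a maximum of $\kappa^2$, with $\mathbf{p}\neq0$ and parameters $a,b\ge0$. (a) In cylindrical coordinates $r,\theta,z$ with respect to the rotation axis of the magnetic field $\mathbf{K}$, the front track, with initial conditions $z(0)=0$ and $\theta(0)=0$, is given by $$r(t)=\frac{1}{|\mathbf{p}|}\sqrt{A-4a\,\mathrm{sn}^2(\omega t,k)},$$ $$\theta(t)=\frac{b}{2|\mathbf{p}|}\left[t+\frac{B}{\omega}\,\Pi(\omega t,n,k)\right],$$ $$z(t)=\frac{1}{2|\mathbf{p}|}\left[(|\mathbf{p}|^2+1)\,t-4\omega\,E(\omega t,k)\right],$$ where $$A=\frac{(|\mathbf{p}|^2+a)^2}{|\mathbf{p}|^2},\quad B=\frac{|\mathbf{p}|^2-a}{|\mathbf{p}|^2+a},\quad |\mathbf{p}|=\sqrt{a^2+b^2},\quad n=\frac{4a}{A},\quad \omega=\frac{\sqrt{(a+1)^2+b^2}}{2},\quad k^2=\frac{4a}{(a+1)^2+b^2}.$$ (b) For $(a,b)\neq(1,0)$, the monodromy is given by $$\Delta\theta=\frac{b}{\omega|\mathbf{p}|}\left[K(k)+B\,\Pi(n,k)\right],\qquad \Delta z=\frac{1}{\omega|\mathbf{p}|}\left[(|\mathbf{p}|^2+1)K(k)-4\omega^2E(k)\right].$$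
   Context: $\mathrm{sn}(u,k)$ is the Jacobi elliptic function of modulus $k$; the incomplete elliptic integrals of the second and third kind are $E(x,k):=x-k^2\int_0^x\mathrm{sn}^2(s,k)\,ds$ and $\Pi(x,n,k):=\int_0^x\frac{ds}{1-n\,\mathrm{sn}^2(s,k)}$; $K(k)$, $E(k):=E(K(k),k)$, $\Pi(n,k):=\Pi(K(k),n,k)$ are the complete elliptic integrals of the first, second and third kinds. A bicycle path in $\mathbb{R}^3$ is a pair of curves $(\mathbf{x}(t),\mathbf{y}(t))$ (front and back tracks) such that $\mathbf{v}:=\mathbf{x}-\mathbf{y}$ satisfies $|\mathbf{v}|=1$ and $\mathbf{y}'\parallel\mathbf{v}$ for all $t$. A bicycling geodesic is a bicycle path whose length (the length of its front track) is critical among bicycle paths connecting two given placements of the segment. Unit speed bicycling geodesics are exactly the bicycle paths for which there exist a constant $\mathbf{p}\in\mathbb{R}^3$ and $\mathbf{r}(t)\in\mathbb{R}^3$ with $$\mathbf{x}'=\mathbf{p}+\mathbf{r},\quad \mathbf{v}'=\mathbf{p}+\mathbf{r}-(\mathbf{v}\cdot\mathbf{p})\mathbf{v},\quad \mathbf{p}'=0,\quad \mathbf{r}'=(\mathbf{v}\cdot\mathbf{p})\mathbf{r}-[\mathbf{r}\cdot(\mathbf{r}+\mathbf{p})]\mathbf{v},\quad |\mathbf{v}|=1,\ \mathbf{r}\cdot\mathbf{v}=0,\ |\mathbf{x}'|=1.$$ Here $b:=\mathbf{p}\cdot(\mathbf{v}\times\mathbf{x}')$ is constant, and $a\ge0$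 is defined by $a^2=|\mathbf{p}|^2-b^2$; by a reflection one may assume $b\ge0$. Non-linear means not a straight line, and $\kappa$ denotes the curvature of the front track. For $\mathbf{p}\ne0$ the front track satisfies $\mathbf{x}''=\mathbf{x}'\times\mathbf{K}$ with $\mathbf{K}=(\mathbf{x}-\mathbf{x}_1)\times\mathbf{p}+\delta\mathbf{p}$, $\mathbf{x}_1=\mathbf{y}(0)+\frac{(\mathbf{x}'(0)\times\mathbf{v}(0))\times\mathbf{p}}{|\mathbf{p}|^2}$, $\delta=-\frac{b}{|\mathbf{p}|^2}$; the rotation axis of $\mathbf{K}$ is the line through $\mathbf{x}_1$ in the direction $\mathbf{p}$, and the $z$ coordinate increases in the direction of $\mathbf{p}$. When $\kappa^2$ is non-constant and periodic, with period $T=2K(k)/\omega$, the monodromy is the orientation preserving isometry $M$ of $\mathbb{R}^3$ with $\mathbf{x}(t+T)=M(\mathbf{x}(t))$ for all $t$; $\Delta\theta$ and $\Delta z$ are the increments of $\theta$ and $z$ over one period $T$, i.e. the rotation angle and the translation of $M$ about the axis.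
   Formalization: If |p|²=a and b>0, then B=0, n=1, the track meets the axis, Π(n,k) diverges and θ jumps by π; so the formula for θ(t) is claimed only while the track stays off the axis, and that for Δθ only when it never meets the axis. *)

(* Defs.v *)
From Stdlib Require Export Reals.
From Coquelicot Require Export Coquelicot.

Open Scope R_scope.

(* [R * R * R] carries Coquelicot's product normed module structure, whose norm
   is the Euclidean one; [plus], [minus], [scal] and [is_derive] below refer to
   it. *)
Notation vec3 := (R * R * R)%type.

Definition dot (u v : vec3) : R :=
  let '(u1, u2, u3) := u in let '(v1, v2, v3) := v in
  u1 * v1 + u2 * v2 + u3 * v3.

Definition cross (u v : vec3) : vec3 :=
  let '(u1, u2, u3) := u in let '(v1, v2, v3) := v in
  (u2 * v3 - u3 * v2, u3 * v1 - u1 * v3, u1 * v2 - u2 * v1).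

Definition vnorm (u : vec3) : R := sqrt (dot u u).

Definition vderive (x : R -> vec3) (t : R) : vec3 :=
  (Derive (fun s => fst (fst (x s))) t,
   Derive (fun s => snd (fst (x s))) t,
   Derive (fun s => snd (x s)) t).

Definition on_line (c d q : vec3) : Prop := exists s : R, q = plus c (scal s d).

Definition linear_track (x : R -> vec3) : Prop :=
  exists c d : vec3, forall t, on_line c d (x t).

(* Only meaningful for curves parametrized by arc length. *)
Definition curvature (x : R -> vec3) (t : R) : R := vnorm (vderive (vderive x) t).

(** * Jacobi's elliptic sine and elliptic integrals, modulus [0 <= k <= 1] *)

(* The amplitude: the angle [phi] such that
   [u = int_0^phi dtheta / sqrt (1 - k^2 sin^2 theta)].  It is unique, also for
   [k = 1], where the integrand is integrable on [[0, phi]] only if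
   [|phi| < PI / 2]; so [jacobi_sn u 1] is the hyperbolic tangent of [u]. *)
Definition jacobi_am (u k : R) : R :=
  iota (fun phi : R =>
    is_RInt (fun theta => / sqrt (1 - k ^ 2 * sin theta ^ 2)) 0 phi u).

Definition jacobi_sn (u k : R) : R := sin (jacobi_am u k).

Definition ellipticK (k : R) : R :=
  RInt (fun theta => / sqrt (1 - k ^ 2 * sin theta ^ 2)) 0 (PI / 2).

Definition ellipticE_inc (x k : R) : R :=
  x - k ^ 2 * RInt (fun s => jacobi_sn s k ^ 2) 0 x.

Definition ellipticPi_inc (x n k : R) : R :=
  RInt (fun s => / (1 - n * jacobi_sn s k ^ 2)) 0 x.

Definition ellipticE (k : R) : R := ellipticE_inc (ellipticK k) k.

Definition ellipticPi (n k : R) : R := ellipticPi_inc (ellipticK k) n k.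

(** * Bicycling geodesics *)

Definition frame_vector (x y : R -> vec3) (t : R) : vec3 := minus (x t) (y t).

Definition bicycle_path (x y : R -> vec3) : Prop :=
  forall t,
    vnorm (frame_vector x y t) = 1 /\
    exists c : R, is_derive y t (scal c (frame_vector x y t)).

(* Unit speed bicycling geodesics, through their equations of motion, together
   with the auxiliary constant vector [p] and curve [r]. *)
Definition bicycling_geodesic (x y : R -> vec3) (p : vec3) (r : R -> vec3) : Prop :=
  bicycle_path x y /\
  forall t,
    let v := frame_vector x y in
    is_derive x t (plus p (r t)) /\
    is_derive v t (minus (plus p (r t)) (scal (dot (v t) p) (v t))) /\
    is_derive r t (minus (scal (dot (v t) p) (r t))
                         (scal (dot (r t) (plus (r t) p)) (v t))) /\
    dot (r t) (v t) = 0 /\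
    vnorm (vderive x t) = 1.

(* [p . (v x x')] is constant along a bicycling geodesic; it is read off at
   time [0]. *)
Definition geodesic_b (x y : R -> vec3) (p : vec3) : R :=
  dot p (cross (frame_vector x y 0) (vderive x 0)).

(* The point [x_1]: the front track solves [x'' = x' x K] for the magnetic field
   [K = (x - x_1) x p - b / |p|^2 p], whose rotation axis is the line through
   [x_1] directed by [p]. *)
Definition axis_point (x y : R -> vec3) (p : vec3) : vec3 :=
  plus (y 0)
       (scal (/ dot p p) (cross (cross (vderive x 0) (frame_vector x y 0)) p)).

(** * Cylindrical coordinates and isometries *)

(* An origin [O] on the line through [c] directed by [p], and the unit vector
   [e1] orthogonal to [p] from which angles are measured. *)
Definition cyl_frame (c p O e1 : vec3) : Prop :=
  on_line c p O /\ vnorm e1 = 1 /\ dot e1 p = 0.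

(* The point [q] has cylindrical coordinates [rho, theta, z] in the direct
   orthonormal frame [O; e1, e3 x e1, e3] with [e3 = p / |p|]. *)
Definition cyl_coords (p O e1 q : vec3) (rho theta z : R) : Prop :=
  let e3 : vec3 := scal (/ vnorm p) p in
  0 <= rho /\
  q = plus O (plus (plus (scal (rho * cos theta) e1)
                         (scal (rho * sin theta) (cross e3 e1)))
                   (scal z e3)).

Definition cyl_coords_of_curve (p O e1 : vec3) (x : R -> vec3)
    (rho theta z : R -> R) : Prop :=
  forall t, cyl_coords p O e1 (x t) (rho t) (theta t) (z t).

(* Between [s] and [t] the curve stays off the axis and [theta] is a continuous
   determination of its polar angle. *)
Definition angle_determination (rho theta : R -> R) (s t : R) : Prop :=
  forall u, Rmin s t <= u <= Rmax s t -> 0 < rho u /\ continuous theta u.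

Definition isometry (M : vec3 -> vec3) : Prop :=
  forall q q', vnorm (minus (M q) (M q')) = vnorm (minus q q').

Definition triple (u v w : vec3) : R := dot u (cross v w).

Definition orientation_preserving_isometry (M : vec3 -> vec3) : Prop :=
  isometry M /\
  forall q q1 q2 q3,
    triple (minus (M q1) (M q)) (minus (M q2) (M q)) (minus (M q3) (M q)) =
    triple (minus q1 q) (minus q2 q) (minus q3 q).

Definition is_monodromy (x : R -> vec3) (T : R) (M : vec3 -> vec3) : Prop :=
  orientation_preserving_isometry M /\ forall t, x (t + T) = M (x t).

(* Rotation by the angle [dtheta] about the axis, followed by translation by
   [dz] along it. *)
Definition screw_motion (p O e1 : vec3) (dtheta dz : R) (M : vec3 -> vec3) : Prop :=
  forall q rho theta z,
    cyl_coords p O e1 q rho theta z ->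
    cyl_coords p O e1 (M q) rho (theta + dtheta) (z + dz).

(** * The parameters of the solution, in terms of [a] and [b] *)

(* [|p|], since [a ^ 2 = |p| ^ 2 - b ^ 2]. *)
Definition par_p (a b : R) : R := sqrt (a ^ 2 + b ^ 2).

Definition par_A (a b : R) : R := (par_p a b ^ 2 + a) ^ 2 / par_p a b ^ 2.

Definition par_B (a b : R) : R := (par_p a b ^ 2 - a) / (par_p a b ^ 2 + a).

Definition par_n (a b : R) : R := 4 * a / par_A a b.

Definition par_omega (a b : R) : R := sqrt ((a + 1) ^ 2 + b ^ 2) / 2.

Definition par_k (a b : R) : R := sqrt (4 * a / ((a + 1) ^ 2 + b ^ 2)).

Definition sol_r (a b t : R) : R :=
  1 / par_p a b *
  sqrt (par_A a b - 4 * a * jacobi_sn (par_omega a b * t) (par_k a b) ^ 2).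

Definition sol_theta (a b t : R) : R :=
  b / (2 * par_p a b) *
  (t + par_B a b / par_omega a b *
       ellipticPi_inc (par_omega a b * t) (par_n a b) (par_k a b)).

Definition sol_z (a b t : R) : R :=
  1 / (2 * par_p a b) *
  ((par_p a b ^ 2 + 1) * t -
   4 * par_omega a b * ellipticE_inc (par_omega a b * t) (par_k a b)).

(* The period of the squared curvature. *)
Definition par_T (a b : R) : R := 2 * ellipticK (par_k a b) / par_omega a b.

Definition delta_theta (a b : R) : R :=
  b / (par_omega a b * par_p a b) *
  (ellipticK (par_k a b) + par_B a b * ellipticPi (par_n a b) (par_k a b)).

Definition delta_z (a b : R) : R :=
  1 / (par_omega a b * par_p a b) *
  ((par_p a b ^ 2 + 1) * ellipticK (par_k a b) -
   4 * par_omega a b ^ 2 * ellipticE (par_k a b)).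

(* Main.v *)
Require Import Defs.
From Stdlib Require Import Classical Ranalysis5 Lra Psatz.

(** Write [q = |p|], [s = x' . p], [c = v . p].  Everything rests on the scalar
    [s], which is [q] times the velocity of the front wheel along the axis.
    Since [|r| ^ 2 = 1 + q ^ 2 - 2 s], the equations of motion give
    [s' = - c |r| ^ 2] and [c' = s - c ^ 2], and the Gram determinant of
    [p, v, r], which is [b ^ 2], gives the first integral
    [c ^ 2 |r| ^ 2 = a ^ 2 - s ^ 2].  The squared curvature turns out to be
    [1 + a ^ 2 - 2 s], so that [s] is minimal at [0], where it is [- a]; then
    [s'' = 3 s ^ 2 - (1 + q ^ 2) s - a ^ 2] has the solution
    [s = - a + 2 a sn ^ 2 (omega t, k)] ([axial_velocity_sn]).  Integrating
    [z' = s / q] gives [z].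

    In the plane orthogonal to the axis, the squared distance to the axis, the
    radial speed and the angular momentum are functions of [s] and [s']:
    [q ^ 2 rho ^ 2 = q ^ 2 + a ^ 2 / q ^ 2 - 2 s] gives [rho], and the angular
    speed [b (q ^ 2 - s) / (q ^ 3 rho ^ 2)] is the derivative of [sol_theta]
    ([frame_planar_motion], [sol_theta_rate]).  A continuous polar angle must
    follow its angular speed ([polar_angle_increment]).

    Because [sn ^ 2] is even and has period [2 K], the increment of a primitive
    over one period is twice its value at the half period, which is where the
    complete integrals come from ([periodic_primitive_increment]).  The planar
    position solves a linear equation with coefficients of period [T] that is
    invariant under rotations; hence the motion one period later is its image
    by a rotation, and the track is carried to itself by a screw motion
    ([planar_motion_period]).  An orientation preserving isometry is determined
    by its values on a track that is not a line, so every monodromy is that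
    screw motion ([monodromy_unique]).  The angle of the rotation is given by
    [sol_theta] when the track avoids the axis.

    The amplitude [jacobi_am] is a definite description; it is identified with
    the solution of [phi' = sqrt (1 - k ^ 2 sin ^ 2 phi)], [phi 0 = 0], uniformly
    for [0 <= k <= 1] ([amplitude_unique], [amplitude_solution_exists]).
    Uniqueness of solutions of differential equations is always obtained from
    [gronwall_zero]. *)

(** * Calculus on the line *)

Ltac rewrite_derivatives :=
  repeat match goal with
  | |- context [Derive ?f ?t] => erewrite (is_derive_unique f t) by eauto
  end.

(** Differentiates the function of a goal [is_derive f t l] with the help of the
    hypotheses on the functions that occur in [f]; what remains is the equation
    between the computed derivative and [l]. *)
Ltac derive :=
  auto_derive;
  [repeat split; try (eexists; solve [eauto]); try lra | rewrite_derivatives].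

Lemma is_derive_continuity_pt (f : R -> R) (t l : R) :
  is_derive f t l -> continuity_pt f t.
Proof.
intro H; apply continuity_pt_filterlim, (ex_derive_continuous f); now exists l.
Qed.

Lemma constant_between (f : R -> R) (s t : R) :
  (forall u, Rmin s t <= u <= Rmax s t -> is_derive f u 0) -> f t = f s.
Proof.
intro H.
destruct (MVT_gen f s t (fun _ => 0)) as [c [_ E]].
- intros u Hu; apply H; lra.
- intros u Hu; eapply is_derive_continuity_pt, H, Hu.
- lra.
Qed.

Lemma increment_eq (f g h : R -> R) :
  (forall t, is_derive f t (h t)) -> (forall t, is_derive g t (h t)) ->
  forall s t, f t - f s = g t - g s.
Proof.
intros Hf Hg s t.
assert (E : f t - g t = f s - g s); [|lra].
apply (constant_between (fun u => f u - g u)); intros u _.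
specialize (Hf u); specialize (Hg u); derive; ring.
Qed.

Lemma derive_at_minimum (f f' : R -> R) (t0 : R) :
  (forall t, is_derive f t (f' t)) -> (forall t, f t0 <= f t) -> f' t0 = 0.
Proof.
intros Hf Hmin.
assert (pr : derivable_pt f t0) by (apply ex_derive_Reals_0; eexists; apply Hf).
rewrite <- (derive_pt_eq_0 f t0 _ pr (proj1 (is_derive_Reals _ _ _) (Hf t0))).
apply (deriv_minimum f (t0 - 1) (t0 + 1)); try lra; auto.
Qed.

(** The increment over a period does not depend on the starting point [t]; it is
    read off at [t = - T / 2], where [G] is odd because [h] is even. *)
Lemma periodic_primitive_increment (G h : R -> R) (T : R) :
  (forall t, is_derive G t (h t)) -> (forall t, h (- t) = h t) ->
  (forall t, h (t + T) = h t) -> G 0 = 0 ->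
  forall t, G (t + T) - G t = 2 * G (T / 2).
Proof.
intros HG Heven Hper H0 t.
assert (Hodd : G (- (T / 2)) = - G (T / 2)).
{ assert (HG' : forall u, is_derive (fun u => - G (- u)) u (h u)).
  { intro u; rewrite <- (Heven u).
    derive. ring. }
  generalize (increment_eq _ _ h HG' HG 0 (T / 2)); simpl.
  rewrite Ropp_0, H0; lra. }
assert (HT : forall u, is_derive (fun u => G (u + T)) u (h u)).
{ intro u; rewrite <- (Hper u). derive. ring. }
generalize (increment_eq _ _ h HT HG (- (T / 2)) t); simpl.
replace (- (T / 2) + T) with (T / 2) by field.
rewrite Hodd; lra.
Qed.

(** A quantity that grows at most exponentially in both directions of time and
    vanishes once vanishes always.  Applied to the squared distance between two
    solutions, this is the uniqueness theorem for differential equations. *)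
Lemma gronwall_zero (E e : R -> R) (C : R) :
  (forall t, is_derive E t (e t)) -> (forall t, 0 <= E t) ->
  (forall t, Rabs (e t) <= C * E t) ->
  forall t0, E t0 = 0 -> forall t, E t = 0.
Proof.
assert (main : forall (E e : R -> R) (C : R),
  (forall t, is_derive E t (e t)) -> (forall t, 0 <= E t) ->
  (forall t, Rabs (e t) <= C * E t) ->
  forall t0, E t0 = 0 -> forall t, t0 < t -> E t = 0).
{ clear E e C; intros E e C HE Hpos Hbd t0 H0 t Ht.
  assert (HG : forall u, is_derive (fun u => E u * exp (- C * (u - t0))) u
            ((e u - C * E u) * exp (- C * (u - t0)))).
  { intro u; derive; unfold Rminus; ring. }
  destruct (MVT_gen (fun u => E u * exp (- C * (u - t0))) t0 t _
              (fun u _ => HG u)) as [xi [_ Hxi]].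
  { intros u _; eapply is_derive_continuity_pt, HG. }
  rewrite H0, Rmult_0_l in Hxi.
  assert (Hle : e xi - C * E xi <= 0).
  { generalize (Hbd xi) (Rle_abs (e xi)); lra. }
  assert (Hle2 : E t * exp (- C * (t - t0)) <= 0).
  { generalize (exp_pos (- C * (xi - t0))).
    set (ex := exp (- C * (xi - t0))) in *.
    set (d := e xi - C * E xi) in *.
    intro. assert (0 <= - d * ex) by nra. assert (0 <= (- d * ex) * (t - t0)) by nra. lra. }
  generalize (exp_pos (- C * (t - t0))) (Hpos t).
  intros; nra. }
intros HE Hpos Hbd t0 H0 t.
destruct (Rtotal_order t0 t) as [H|[<-|H]]; [eauto|exact H0|].
rewrite <- (Ropp_involutive t).
apply (main (fun u => E (- u)) (fun u => - e (- u)) C) with (t0 := - t0); try lra.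
- intro u. derive. ring.
- intro u; apply Hpos.
- intro u; rewrite Rabs_Ropp; apply Hbd.
- now rewrite Ropp_involutive.
Qed.

(** * The Jacobi amplitude *)

Definition legendre (k theta : R) : R := / sqrt (1 - k ^ 2 * sin theta ^ 2).

Lemma legendre_modulus_lt1 k x : 0 <= k < 1 -> 0 < 1 - k ^ 2 * sin x ^ 2.
Proof.
intros Hk; generalize (sin2_cos2 x); unfold Rsqr; intro.
assert (k ^ 2 < 1) by nra. assert (0 <= sin x ^ 2 <= 1) by nra. nra.
Qed.

Lemma legendre_nonneg k theta : 0 <= legendre k theta.
Proof.
unfold legendre; destruct (sqrt_pos (1 - k ^ 2 * sin theta ^ 2)) as [H|H].
- left; now apply Rinv_0_lt_compat.
- rewrite <- H, Rinv_0; lra.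
Qed.

(** The differential equation of the inverse of
    [phi |-> RInt (legendre k) 0 phi], with [1 - k ^ 2 * sin phi ^ 2] kept away
    from [0] so that, for [k = 1], the solution stays between [- PI / 2] and
    [PI / 2]. *)
Definition amplitude_solution (k : R) (phi : R -> R) : Prop :=
  phi 0 = 0 /\
  forall u, 0 < 1 - k ^ 2 * sin (phi u) ^ 2 /\
            is_derive phi u (sqrt (1 - k ^ 2 * sin (phi u) ^ 2)).

Lemma legendre_continuous k theta :
  0 < 1 - k ^ 2 * sin theta ^ 2 -> continuous (legendre k) theta.
Proof.
intro H; apply (ex_derive_continuous (legendre k)).
unfold legendre; auto_derive; repeat split.
- lra.
- apply Rgt_not_eq, sqrt_lt_R0; lra.
Qed.

(** Under the substitution [theta = phi y] the integrand becomes [1]. *)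
Lemma amplitude_solution_RInt k phi :
  amplitude_solution k phi -> forall u, is_RInt (legendre k) 0 (phi u) u.
Proof.
intros [H0 H] u.
assert (Hc : is_RInt (fun y => scal (sqrt (1 - k ^ 2 * sin (phi y) ^ 2))
                        (legendre k (phi y))) 0 u (u - 0)).
{ apply (is_RInt_ext (fun _ => 1)).
  - intros y _; destruct (H y) as [Hy _]; unfold scal; simpl; unfold mult; simpl.
    unfold legendre; symmetry; apply Rinv_r, Rgt_not_eq, sqrt_lt_R0, Hy.
  - replace (u - 0) with (scal (u - 0) 1) by (unfold scal; simpl; unfold mult; simpl; ring).
    apply (is_RInt_const 0 u 1). }
assert (Hex : ex_RInt (legendre k) 0 (phi u)).
{ rewrite <- H0.
  apply (ex_RInt_continuous (legendre k)); intros z Hz.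
  assert (Hphi : continuity phi).
  { intro y; eapply is_derive_continuity_pt, H. }
  destruct (IVT_gen phi 0 u z Hphi Hz) as [y [_ <-]].
  apply legendre_continuous, H. }
assert (Hcomp : is_RInt (fun y => scal (sqrt (1 - k ^ 2 * sin (phi y) ^ 2))
                        (legendre k (phi y))) 0 u (RInt (legendre k) (phi 0) (phi u))).
{ apply (is_RInt_comp (legendre k) phi).
  - intros y _; apply legendre_continuous, H.
  - intros y _; split; [apply H|].
    apply (ex_derive_continuous (fun y => sqrt (1 - k ^ 2 * sin (phi y) ^ 2))).
    destruct (H y) as [Hy Hd]. auto_derive; repeat split; [eexists; eauto | lra]. }
rewrite H0 in Hcomp.
assert (E : RInt (legendre k) 0 (phi u) = u).
{ apply (is_RInt_unique (V := R_CompleteNormedModule)) in Hcomp.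
  apply (is_RInt_unique (V := R_CompleteNormedModule)) in Hc; lra. }
rewrite <- E at 2. now apply (RInt_correct (legendre k)).
Qed.

Lemma is_RInt_nonneg_mono (f : R -> R) a b c u w :
  (forall x, 0 <= f x) -> a <= b <= c -> is_RInt f a b u -> is_RInt f a c w -> u <= w.
Proof.
intros Hf Habc Hu Hw.
assert (Hbc : ex_RInt f b c).
{ apply (ex_RInt_Chasles_2 (V := R_CompleteNormedModule) f a b c); [exact Habc|]; eexists; eauto. }
generalize (is_RInt_Chasles f a b c _ _ Hu (RInt_correct _ _ _ Hbc)); intro H.
apply (is_RInt_unique (V := R_CompleteNormedModule)) in Hw.
apply (is_RInt_unique (V := R_CompleteNormedModule)) in H; rewrite Hw in H.
rewrite H; unfold plus; simpl.
assert (0 <= RInt f b c) by (apply RInt_ge_0; intuition).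
lra.
Qed.

(** Let [w > |u|].  Between [phi (- w)] and [phi w], the angle [psi] is a value of
    [phi] and the integral tells which one.  Beyond them the integral up to
    [psi] of a nonnegative function would be at least [w] in absolute value;
    this is how, for [k = 1], the angles beyond [PI / 2] are ruled out without
    discussing the singularity. *)
Lemma amplitude_unique k phi :
  amplitude_solution k phi -> forall u psi, is_RInt (legendre k) 0 psi u -> psi = phi u.
Proof.
intros Hs u psi Hpsi.
generalize (amplitude_solution_RInt k phi Hs); intro HI.
destruct Hs as [H0 H].
assert (Hcont : continuity phi).
{ intro y; eapply is_derive_continuity_pt, H. }
assert (Hmono : forall s t, s < t -> phi s < phi t).
{ intros s t Hst.
  apply (incr_function_le phi s t _ (fun v _ _ => proj2 (H v))); simpl; try lra.
  intros v _ _; apply sqrt_lt_R0, H. }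
set (w := Rabs u + 1).
assert (Hw : - w < u < w) by (unfold w; split_Rabs; lra).
destruct (Rle_or_lt psi (phi w)) as [Hle|Hgt].
- destruct (Rle_or_lt (phi (- w)) psi) as [Hle2|Hgt].
  + destruct (IVT_gen phi (- w) w psi Hcont) as [v [_ Hv]].
    { rewrite Rmin_left, Rmax_right by lra; lra. }
    rewrite <- Hv in Hpsi.
    apply (is_RInt_unique (V := R_CompleteNormedModule)) in Hpsi; rewrite (is_RInt_unique _ _ _ _ (HI v)) in Hpsi.
    now rewrite <- Hpsi, Hv.
  + exfalso. assert (phi (- w) < phi 0) by (apply Hmono; lra).
    apply is_RInt_swap in Hpsi.
    generalize (is_RInt_swap _ _ _ _ (HI (- w))); intro HI'.
    assert (Hneg : forall l g, is_RInt (legendre k) l 0 g ->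
              is_RInt (fun y => legendre k (- y)) 0 (- l) g).
    { intros l g Hg.
      generalize (is_RInt_comp_opp (legendre k) (-0) (-l) (opp g)).
      rewrite !Ropp_involutive; intro Hc.
      apply is_RInt_swap, Hc, is_RInt_opp in Hg.
      rewrite opp_opp, Ropp_0 in Hg.
      apply (is_RInt_ext _ (fun y => legendre k (- y))) in Hg; [exact Hg|].
      intros; apply opp_opp. }
    generalize (is_RInt_nonneg_mono _ 0 (- phi (- w)) (- psi) _ _
      (fun y => legendre_nonneg k (- y)) ltac:(lra)
      (Hneg _ _ HI') (Hneg _ _ Hpsi)).
    unfold opp; simpl; lra.
- exfalso. assert (phi 0 < phi w) by (apply Hmono; lra).
  generalize (is_RInt_nonneg_mono _ 0 (phi w) psi _ _ (legendre_nonneg k)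
    ltac:(lra) (HI w) Hpsi); lra.
Qed.

Lemma amplitude_solution_am k phi :
  amplitude_solution k phi -> forall u, jacobi_am u k = phi u.
Proof.
intros Hs u; unfold jacobi_am; apply (iota_unique (V := R_CompleteNormedModule)).
- intros psi Hpsi; now apply (amplitude_unique k).
- now apply amplitude_solution_RInt.
Qed.

(** The primitive expands distances because [f] is at least [1]; so it is a
    bijection of the line and its inverse is 1-Lipschitz, which gives the limit
    of the difference quotient through the mean value theorem. *)
Lemma inverse_of_primitive (f : R -> R) :
  (forall x, continuous f x) -> (forall x, 1 <= f x) ->
  exists g : R -> R, g 0 = 0 /\ forall u, is_derive g u (/ f (g u)).
Proof.
intros Hc Hf.
set (F := (fun x => RInt f 0 x) : R -> R).
assert (HF : forall x, is_derive F x (f x)).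
{ intro x; apply (is_derive_RInt f F 0 x); [|apply Hc].
  apply filter_forall; intro y; apply (RInt_correct f), (ex_RInt_continuous f); auto. }
assert (HFc : continuity F).
{ intro x; eapply is_derive_continuity_pt, HF. }
assert (F0 : F 0 = 0) by (unfold F; rewrite RInt_point; reflexivity).
assert (MV : forall x y, exists c, Rmin x y <= c <= Rmax x y /\ F y - F x = f c * (y - x)).
{ intros x y; apply MVT_gen; intros; [apply HF|apply HFc]. }
assert (exg : forall u, {x | F x = u}).
{ intro u.
  destruct (IVT_gen F (- Rabs u) (Rabs u) u HFc) as [x [_ Hx]]; [|now exists x].
  destruct (MV 0 (Rabs u)) as [c [_ E]]; destruct (MV (- Rabs u) 0) as [c' [_ E']].
  rewrite F0 in *.
  generalize (Hf c) (Hf c') (Rabs_pos u); intros.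
  assert (- Rabs u <= u <= Rabs u) by (split_Rabs; lra).
  split; [apply (Rle_trans _ _ _ (Rmin_l _ _))|apply (Rle_trans _ (F (Rabs u)));
    [|apply Rmax_r]]; nra. }
set (g := fun u => proj1_sig (exg u)).
assert (Fg : forall u, F (g u) = u) by (intro u; unfold g; destruct (exg u); auto).
exists g; split.
- destruct (MV 0 (g 0)) as [c [_ E]]; rewrite Fg, F0 in E.
  generalize (Hf c); intro. nra.
- intro u; apply is_derive_Reals; intros eps Heps.
  assert (Hlip : forall v, Rabs (g v - g u) <= Rabs (v - u)).
  { intro v; destruct (MV (g u) (g v)) as [c [_ E]]; rewrite !Fg in E.
    rewrite E, Rabs_mult, (Rabs_right (f c)) by (generalize (Hf c); lra).
    generalize (Hf c) (Rabs_pos (g v - g u)); nra. }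
  assert (Hci : continuous (fun x => / f x) (g u)).
  { apply continuous_comp; [apply Hc|].
    apply continuous_Rinv; generalize (Hf (g u)); lra. }
  destruct (proj1 (filterlim_locally _ _) Hci (mkposreal eps Heps)) as [d Hd].
  exists d; intros h Hh Hhd.
  destruct (MV (g u) (g (u + h))) as [c [Hcin E]]; rewrite !Fg in E.
  assert (Hfc := Hf c).
  replace ((g (u + h) - g u) / h) with (/ f c).
  2:{ assert (E2 : g (u + h) - g u = / f c * h).
      { replace h with (u + h - u) at 2 by ring. rewrite E. field. lra. }
      rewrite E2. field. split; lra. }
  apply Hd. unfold ball; simpl; unfold AbsRing_ball, abs, minus, plus, opp; simpl.
  apply Rle_lt_trans with (2 := Hhd).
  generalize (Hlip (u + h)).
  replace (u + h - u) with h by ring.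
  intro Hl. apply Rle_trans with (2 := Hl).
  revert Hcin. unfold Rmin, Rmax; destruct (Rle_dec (g u) (g (u + h))); intro; split_Rabs; lra.
Qed.

(** For [k < 1] the integrand is at least [1] and [inverse_of_primitive] applies;
    for [k = 1] the solution is the Gudermannian [atan (sinh u)]. *)
Lemma amplitude_solution_exists k : 0 <= k <= 1 -> exists phi, amplitude_solution k phi.
Proof.
intros [Hk [Hk1| ->]].
- assert (Hpos := fun x => legendre_modulus_lt1 k x (conj Hk Hk1)).
  destruct (inverse_of_primitive (legendre k)) as [g [g0 Hg]].
  + intro x; apply legendre_continuous, Hpos.
  + intro x; unfold legendre; rewrite <- Rinv_1 at 1.
    apply Rinv_le_contravar; [apply sqrt_lt_R0, Hpos|].
    rewrite <- sqrt_1 at 2. apply sqrt_le_1_alt.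
    assert (0 <= (k * sin x) ^ 2) by apply pow2_ge_0. nra.
  + exists g; split; [exact g0|]; intro u; split; [apply Hpos|].
    generalize (Hg u); unfold legendre; now rewrite Rinv_inv.
- exists (fun u => atan ((exp u - exp (- u)) / 2)).
  assert (Hcos : forall u, 1 - 1 ^ 2 * sin (atan ((exp u - exp (- u)) / 2)) ^ 2
            = (2 / (exp u + exp (- u))) ^ 2).
  { intro u; generalize (exp_pos u) (exp_pos (- u)); intros.
    assert (Ee : exp u * exp (- u) = 1) by (rewrite <- exp_plus, Rplus_opp_r; apply exp_0).
    rewrite sin_atan.
    replace (1 + ((exp u - exp (- u)) / 2)²) with (((exp u + exp (- u)) / 2) ^ 2).
    2:{ unfold Rsqr; nra. }
    rewrite sqrt_pow2 by lra.
    field_simplify; [|lra|lra]. f_equal. nra. }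
  split; [rewrite Ropp_0, exp_0; replace ((1 - 1) / 2) with 0 by field; apply atan_0|].
  intro u; rewrite Hcos.
  generalize (exp_pos u) (exp_pos (- u)); intros.
  assert (Ee : exp u * exp (- u) = 1) by (rewrite <- exp_plus, Rplus_opp_r; apply exp_0).
  assert (Hp : 0 < 2 / (exp u + exp (- u))) by (apply Rdiv_lt_0_compat; lra).
  split; [now apply pow_lt|].
  rewrite sqrt_pow2 by lra.
  auto_derive; [exact I|].
  match goal with |- _ * / ?d = _ =>
    replace d with (((exp u + exp (- u)) / 2) ^ 2) by nra
  end.
  field; lra.
Qed.

Lemma am_solution k : 0 <= k <= 1 -> amplitude_solution k (fun u => jacobi_am u k).
Proof.
intro Hk; destruct (amplitude_solution_exists k Hk) as [phi Hphi].
assert (E := amplitude_solution_am k phi Hphi).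
destruct Hphi as [H0 H].
split; [now rewrite E|]; intro u; rewrite E; split; [apply H|].
apply is_derive_ext with phi; [auto|apply H].
Qed.

Lemma sn_bounds k u : 0 <= k <= 1 -> 0 <= jacobi_sn u k ^ 2 <= 1.
Proof.
intros Hk; unfold jacobi_sn.
generalize (sin2_cos2 (jacobi_am u k)); unfold Rsqr; nra.
Qed.

Lemma sn_derive k : 0 <= k <= 1 ->
  forall u, is_derive (fun u => jacobi_sn u k) u
    (cos (jacobi_am u k) * sqrt (1 - k ^ 2 * jacobi_sn u k ^ 2)).
Proof.
intros Hk u; unfold jacobi_sn.
destruct (am_solution k Hk) as [_ H]; destruct (H u) as [_ Hd].
derive. ring.
Qed.

Lemma sn2_continuous k u : 0 <= k <= 1 -> continuous (fun s => jacobi_sn s k ^ 2) u.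
Proof.
intro Hk; apply (ex_derive_continuous (fun s => jacobi_sn s k ^ 2)).
generalize (sn_derive k Hk); intro H. auto_derive; repeat split. eexists; apply H.
Qed.

(** [S = sn ^ 2] satisfies a polynomial equation of the second order, which
    determines it together with [S 0 = S' 0 = 0]; [w] is its derivative. *)
Lemma sn2_second_derivative k : 0 <= k <= 1 ->
  exists w : R -> R, w 0 = 0 /\
    (forall u, is_derive (fun s => jacobi_sn s k ^ 2) u (w u)) /\
    forall u, is_derive w u
      (2 * (1 - 2 * (1 + k ^ 2) * jacobi_sn u k ^ 2 + 3 * k ^ 2 * (jacobi_sn u k ^ 2) ^ 2)).
Proof.
intro Hk.
exists (fun u => 2 * jacobi_sn u k * cos (jacobi_am u k) * sqrt (1 - k ^ 2 * jacobi_sn u k ^ 2)).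
assert (Hsn := sn_derive k Hk).
destruct (am_solution k Hk) as [H0 H].
split; [unfold jacobi_sn; rewrite H0, sin_0; ring|split].
- intro u; derive; ring.
- intro u; unfold jacobi_sn; destruct (H u) as [Hpos Hd].
  set (q := sqrt (1 - k ^ 2 * sin (jacobi_am u k) ^ 2)) in *.
  assert (Hq : q * q = 1 - k ^ 2 * sin (jacobi_am u k) ^ 2)
    by (apply sqrt_sqrt; lra).
  assert (q <> 0) by (unfold q; apply Rgt_not_eq, sqrt_lt_R0, Hpos).
  derive.
  match goal with |- context [sqrt ?x] =>
    replace (sqrt x) with q by (unfold q; f_equal; ring)
  end.
  assert (Hsc := sin2_cos2 (jacobi_am u k)); unfold Rsqr in Hsc.
  clearbody q.
  set (S := sin (jacobi_am u k)) in *; set (C := cos (jacobi_am u k)) in *.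
  transitivity (2 * (q * q) * (C * C - S * S) - 2 * k ^ 2 * (S * S) * (C * C)); [now field|].
  rewrite Hq; replace (C * C) with (1 - S * S) by lra; ring.
Qed.

(** [2 K] is the integral over the period [PI] of the even function
    [legendre k]. *)
Lemma am_shift k : 0 <= k < 1 ->
  forall u, jacobi_am (u + 2 * ellipticK k) k = jacobi_am u k + PI /\
            jacobi_am (- u) k = - jacobi_am u k.
Proof.
intros Hk u.
assert (Hk' : 0 <= k <= 1) by lra.
assert (Hs := am_solution k Hk').
assert (HI := amplitude_solution_RInt k _ Hs u). simpl in HI.
set (F := (fun x => RInt (legendre k) 0 x) : R -> R).
assert (Hex : forall x, is_RInt (legendre k) 0 x (F x)).
{ intro x; apply (RInt_correct (legendre k)), (ex_RInt_continuous (legendre k)); intros.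
  now apply legendre_continuous, legendre_modulus_lt1. }
assert (HF : forall x, is_derive F x (legendre k x)).
{ intro x; apply (is_derive_RInt (legendre k) F 0 x).
  - apply filter_forall; intro y; apply Hex.
  - now apply legendre_continuous, legendre_modulus_lt1. }
assert (F0 : F 0 = 0) by (unfold F; rewrite RInt_point; reflexivity).
assert (Fam : F (jacobi_am u k) = u) by now apply is_RInt_unique.
split; symmetry; apply (amplitude_unique k _ Hs).
- replace (u + 2 * ellipticK k) with (F (jacobi_am u k + PI)); [apply Hex|].
  generalize (periodic_primitive_increment F (legendre k) PI HF); intro P.
  assert (P' := fun a b => P a b F0 (jacobi_am u k)).
  rewrite Fam in P'.
  unfold ellipticK. change (RInt _ 0 (PI / 2)) with (F (PI / 2)).
  rewrite <- P'; [ring| |]; intro x; unfold legendre;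
    [rewrite sin_neg|rewrite neg_sin]; f_equal; f_equal; ring.
- replace (- u) with (F (- jacobi_am u k)); [apply Hex|].
  assert (HF' : forall x, is_derive (fun x => - F (- x)) x (legendre k x)).
  { intro x; replace (legendre k x) with (legendre k (- x))
      by (unfold legendre; rewrite sin_neg; f_equal; f_equal; ring).
    derive. ring. }
  generalize (increment_eq _ _ _ HF' HF 0 (jacobi_am u k)); simpl.
  rewrite Ropp_0, F0, Fam; lra.
Qed.

Lemma sn2_even_periodic k : 0 <= k < 1 ->
  forall u, jacobi_sn (- u) k ^ 2 = jacobi_sn u k ^ 2 /\
            jacobi_sn (u + 2 * ellipticK k) k ^ 2 = jacobi_sn u k ^ 2.
Proof.
intros Hk u; unfold jacobi_sn; destruct (am_shift k Hk u) as [-> ->].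
rewrite sin_neg, neg_sin; split; ring.
Qed.

(** * The parameters and the closed forms *)

Section ClosedForms.
Variables a b : R.
Hypothesis Ha : 0 <= a.
Hypothesis Hab : 0 < a ^ 2 + b ^ 2.

Lemma par_p_pos : 0 < par_p a b.
Proof. now apply sqrt_lt_R0. Qed.

Lemma par_p_sqr : par_p a b ^ 2 = a ^ 2 + b ^ 2.
Proof. unfold par_p; rewrite pow2_sqrt; lra. Qed.

Lemma par_omega_pos : 0 < par_omega a b.
Proof.
unfold par_omega; apply Rdiv_lt_0_compat; [apply sqrt_lt_R0|]; nra.
Qed.

Lemma par_omega_sqr : 4 * par_omega a b ^ 2 = (a + 1) ^ 2 + b ^ 2.
Proof.
unfold par_omega.
replace (4 * (sqrt ((a + 1) ^ 2 + b ^ 2) / 2) ^ 2)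
  with (sqrt ((a + 1) ^ 2 + b ^ 2) ^ 2) by field.
apply pow2_sqrt; nra.
Qed.

Lemma par_k_sqr : par_k a b ^ 2 = 4 * a / ((a + 1) ^ 2 + b ^ 2).
Proof.
unfold par_k; apply pow2_sqrt, Rdiv_le_0_compat; nra.
Qed.

Lemma par_omega_k_sqr : par_omega a b ^ 2 * par_k a b ^ 2 = a.
Proof.
rewrite par_k_sqr; replace (par_omega a b ^ 2) with (((a + 1) ^ 2 + b ^ 2) / 4)
  by (rewrite <- par_omega_sqr; field).
field; nra.
Qed.

Lemma par_k_bounds : 0 <= par_k a b <= 1.
Proof.
split; [apply sqrt_pos|].
unfold par_k; rewrite <- sqrt_1 at 2; apply sqrt_le_1_alt.
apply <- Rcomplements.Rle_div_l; generalize (pow2_ge_0 (a - 1)) (pow2_ge_0 b); nra.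
Qed.

Lemma par_k_lt_1 : (a, b) <> (1, 0) -> par_k a b < 1.
Proof.
intro H; unfold par_k; rewrite <- sqrt_1 at 2; apply sqrt_lt_1_alt.
split; [apply Rdiv_le_0_compat; nra|].
apply <- Rcomplements.Rlt_div_l; [|nra].
assert (0 < (a - 1) ^ 2 + b ^ 2); [|nra].
generalize (pow2_ge_0 (a - 1)) (pow2_ge_0 b); intros.
destruct (Req_dec b 0) as [->|Hb].
- assert (a - 1 <> 0) by (intro; apply H; f_equal; lra).
  generalize (pow2_gt_0 (a - 1)); lra.
- generalize (pow2_gt_0 b); lra.
Qed.

Definition sn2 (t : R) : R := jacobi_sn (par_omega a b * t) (par_k a b) ^ 2.

Lemma sn2_bounds t : 0 <= sn2 t <= 1.
Proof. exact (sn_bounds _ _ par_k_bounds). Qed.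

Lemma sol_z_derive t :
  is_derive (sol_z a b) t ((- a + 2 * a * sn2 t) / par_p a b).
Proof.
assert (Hq := par_p_pos); assert (Hw := par_omega_pos).
assert (HI : forall u, is_derive (fun x => RInt (fun s => jacobi_sn s (par_k a b) ^ 2) 0 x) u
          (jacobi_sn u (par_k a b) ^ 2)).
{ intro u; apply (is_derive_RInt (fun s => jacobi_sn s (par_k a b) ^ 2) _ 0).
  - apply filter_forall; intro v.
    apply (RInt_correct (fun s => jacobi_sn s (par_k a b) ^ 2)).
    apply (ex_RInt_continuous (fun s => jacobi_sn s (par_k a b) ^ 2)); intros.
    apply sn2_continuous, par_k_bounds.
  - apply sn2_continuous, par_k_bounds. }
unfold sol_z, ellipticE_inc.
set (I := (fun x => RInt (fun s => jacobi_sn s (par_k a b) ^ 2) 0 x) : R -> R) in HI.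
apply (is_derive_ext (fun t => 1 / (2 * par_p a b) * ((par_p a b ^ 2 + 1) * t -
   4 * par_omega a b * (par_omega a b * t - par_k a b ^ 2 * I (par_omega a b * t))))).
{ reflexivity. }
derive. unfold sn2.
set (S := jacobi_sn (par_omega a b * t) (par_k a b) ^ 2).
transitivity (1 / (2 * par_p a b) * (par_p a b ^ 2 + 1 - 4 * par_omega a b ^ 2
   + 4 * (par_omega a b ^ 2 * par_k a b ^ 2) * S)); [field; lra|].
rewrite par_omega_k_sqr, par_omega_sqr, par_p_sqr; field; lra.
Qed.

Lemma sol_z_0 : sol_z a b 0 = 0.
Proof.
unfold sol_z, ellipticE_inc; rewrite !Rmult_0_r, RInt_point.
unfold zero; simpl; ring.
Qed.

Lemma par_A_pos : 0 < par_A a b.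
Proof.
assert (Hq := par_p_pos).
unfold par_A; apply Rdiv_lt_0_compat; apply pow_lt; [|exact Hq].
generalize (pow_lt _ 2 Hq); lra.
Qed.

(** [par_n < 1] unless [par_B = 0].  When [par_B = 0], [par_n = 1] and the
    integrand of the elliptic integral of the third kind has poles where the
    track meets the axis, but the coefficient of the integral vanishes; so the
    formula holds in all cases. *)
Lemma sol_theta_derive t :
  is_derive (sol_theta a b) t
    (b / (2 * par_p a b) * (1 + par_B a b / (1 - par_n a b * sn2 t))).
Proof.
assert (Hq := par_p_pos); assert (Hw := par_omega_pos).
destruct (Req_dec (par_B a b) 0) as [HB|HB].
- unfold sol_theta; rewrite HB.
  apply (is_derive_ext (fun t => b / (2 * par_p a b) * t)).
  { intro u; change (b / (2 * par_p a b) * u = b / (2 * par_p a b) *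
      (u + 0 / par_omega a b * ellipticPi_inc (par_omega a b * u) (par_n a b) (par_k a b))).
    unfold Rdiv; ring. }
  auto_derive; [exact I|]. unfold Rdiv; ring.
- set (q := par_p a b) in *.
  assert (Hn : 0 <= par_n a b < 1).
  { unfold par_n, par_A; fold q.
    assert (H2 : q ^ 2 <> a).
    { intro E; apply HB; unfold par_B; fold q; rewrite E; unfold Rdiv; ring. }
    replace (4 * a / ((q ^ 2 + a) ^ 2 / q ^ 2)) with (4 * a * q ^ 2 / (q ^ 2 + a) ^ 2)
      by (field; split; [lra|generalize (pow_lt _ 2 Hq); lra]).
    assert (0 < q ^ 2) by now apply pow_lt.
    split.
    - apply Rdiv_le_0_compat; nra.
    - apply <- Rcomplements.Rlt_div_l; [|nra].
      assert (0 < (q ^ 2 - a) ^ 2) by (apply pow2_gt_0; lra). nra. }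
  assert (Hden : forall u, 0 < 1 - par_n a b * jacobi_sn u (par_k a b) ^ 2).
  { intro u; generalize (sn_bounds _ u par_k_bounds); nra. }
  assert (Hcont : forall u, continuous (fun s => / (1 - par_n a b * jacobi_sn s (par_k a b) ^ 2)) u).
  { intro u; apply (ex_derive_continuous (fun s => / (1 - par_n a b * jacobi_sn s (par_k a b) ^ 2))).
    generalize (sn_derive _ par_k_bounds); intro Hsn.
    auto_derive; repeat split; [eexists; apply Hsn|]. specialize (Hden u); lra. }
  assert (HI : forall u, is_derive
            (fun x => RInt (fun s => / (1 - par_n a b * jacobi_sn s (par_k a b) ^ 2)) 0 x) u
            (/ (1 - par_n a b * jacobi_sn u (par_k a b) ^ 2))).
  { intro u; apply (is_derive_RInt (fun s => / (1 - par_n a b * jacobi_sn s (par_k a b) ^ 2)) _ 0);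
      [|apply Hcont].
    apply filter_forall; intro v.
    apply (RInt_correct (fun s => / (1 - par_n a b * jacobi_sn s (par_k a b) ^ 2))).
    apply (ex_RInt_continuous (fun s => / (1 - par_n a b * jacobi_sn s (par_k a b) ^ 2))); auto. }
  unfold sol_theta, ellipticPi_inc; fold q.
  set (I := (fun x => RInt (fun s => / (1 - par_n a b * jacobi_sn s (par_k a b) ^ 2)) 0 x)
    : R -> R) in HI.
  apply (is_derive_ext (fun t => b / (2 * q) *
    (t + par_B a b / par_omega a b * I (par_omega a b * t)))); [reflexivity|].
  derive. unfold sn2. field. split; [|split]; try lra.
  generalize (Hden (par_omega a b * t)); lra.
Qed.

Lemma sol_theta_0 : sol_theta a b 0 = 0.
Proof.
unfold sol_theta, ellipticPi_inc; rewrite Rmult_0_r, RInt_point.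
unfold zero; simpl; ring.
Qed.

(** The right-hand side is the derivative of [sol_theta]; with [(xi, eta)] the
    velocity of the point [(x, y)], the left-hand side is its angular speed. *)
Lemma sol_theta_rate (s x y xi eta : R) (t : R) :
  0 < x ^ 2 + y ^ 2 -> s = - a + 2 * a * sn2 t ->
  par_p a b ^ 2 * (x ^ 2 + y ^ 2) = par_p a b ^ 2 + a ^ 2 / par_p a b ^ 2 - 2 * s ->
  par_p a b ^ 3 * (x * eta - y * xi) = b * (par_p a b ^ 2 - s) ->
  (x * eta - y * xi) / (x ^ 2 + y ^ 2) =
  b / (2 * par_p a b) * (1 + par_B a b / (1 - par_n a b * sn2 t)).
Proof.
assert (Hq := par_p_pos).
intros Hpos Hs Hn Hl.
unfold par_B, par_n, par_A.
set (q := par_p a b) in *.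
assert (Hq2 : 0 < q ^ 2) by now apply pow_lt.
replace (x * eta - y * xi) with (b * (q ^ 2 - s) / q ^ 3) by (rewrite <- Hl; field; lra).
assert (Hw : 0 < q ^ 2 + a ^ 2 / q ^ 2 - 2 * s) by (rewrite <- Hn; now apply Rmult_lt_0_compat).
replace (x ^ 2 + y ^ 2) with ((q ^ 2 + a ^ 2 / q ^ 2 - 2 * s) / q ^ 2) by (rewrite <- Hn; field; lra).
assert (Hw' : q ^ 2 + a ^ 2 / q ^ 2 - 2 * s = ((q ^ 2 + a) ^ 2 - 4 * a * q ^ 2 * sn2 t) / q ^ 2)
  by (rewrite Hs; field; lra).
rewrite Hw' in Hw |- *.
assert (Hnum : 0 < (q ^ 2 + a) ^ 2 - 4 * a * q ^ 2 * sn2 t).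
{ apply (Rmult_lt_reg_r (/ q ^ 2)); [now apply Rinv_0_lt_compat|]. rewrite Rmult_0_l; exact Hw. }
rewrite Hs; field; repeat split; lra.
Qed.

Hypothesis Hk : (a, b) <> (1, 0).

Lemma sn2_even_periodic_T t : sn2 (- t) = sn2 t /\ sn2 (t + par_T a b) = sn2 t.
Proof.
assert (Hw := par_omega_pos).
destruct (sn2_even_periodic (par_k a b)
  (conj (proj1 par_k_bounds) (par_k_lt_1 Hk)) (par_omega a b * t)) as [E1 E2].
unfold sn2, par_T; split; [rewrite <- E1|rewrite <- E2]; do 2 f_equal; field; lra.
Qed.

Lemma sol_z_increment t : sol_z a b (t + par_T a b) - sol_z a b t = delta_z a b.
Proof.
assert (Hw := par_omega_pos); assert (Hq := par_p_pos).
rewrite (periodic_primitive_increment _ _ _ sol_z_derive).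
- unfold delta_z, ellipticE, sol_z, par_T.
  replace (par_omega a b * (2 * ellipticK (par_k a b) / par_omega a b / 2))
    with (ellipticK (par_k a b)) by (field; lra).
  field; lra.
- intro u; now rewrite (proj1 (sn2_even_periodic_T u)).
- intro u; now rewrite (proj2 (sn2_even_periodic_T u)).
- exact sol_z_0.
Qed.

Lemma sol_theta_increment t :
  sol_theta a b (t + par_T a b) - sol_theta a b t = delta_theta a b.
Proof.
assert (Hw := par_omega_pos); assert (Hq := par_p_pos).
rewrite (periodic_primitive_increment _ _ _ sol_theta_derive).
- unfold delta_theta, ellipticPi, sol_theta, par_T.
  replace (par_omega a b * (2 * ellipticK (par_k a b) / par_omega a b / 2))
    with (ellipticK (par_k a b)) by (field; lra).
  field; lra.
- intro u; now rewrite (proj1 (sn2_even_periodic_T u)).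
- intro u; now rewrite (proj2 (sn2_even_periodic_T u)).
- exact sol_theta_0.
Qed.

End ClosedForms.

(** * The axial velocity is an elliptic function *)

(** Here [s = x' . p], [c = v . p], and [1 + |p| ^ 2 - 2 s] is [|r| ^ 2].  By the
    first integral, [s] lies between [- a] and [a].  At a minimum of [s] either
    [c = 0], hence [s = - a] or [s = a], or [r] vanishes; but then it would vanish
    identically because [(|r| ^ 2)' = 2 c |r| ^ 2].  If the minimum is [a], then
    [s] is constant, [c = 0] and [s = c' + c ^ 2 = 0], so [s = - a] anyway.
    Therefore [s] solves
    [s'' = 3 s ^ 2 - (1 + |p| ^ 2) s - a ^ 2] with [s = - a], [s' = 0] at [0],
    which is also the case of [- a + 2 a sn ^ 2]. *)
Lemma axial_velocity_sn (a b : R) (s c : R -> R) :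
  0 <= a -> 0 < a ^ 2 + b ^ 2 ->
  (forall t, is_derive s t (- c t * (1 + (a ^ 2 + b ^ 2) - 2 * s t))) ->
  (forall t, is_derive c t (s t - c t ^ 2)) ->
  (forall t, c t ^ 2 * (1 + (a ^ 2 + b ^ 2) - 2 * s t) = a ^ 2 - s t ^ 2) ->
  (forall t, 0 <= 1 + (a ^ 2 + b ^ 2) - 2 * s t) ->
  (forall t, c t ^ 2 <= a ^ 2 + b ^ 2) ->
  ~ (forall t, 1 + (a ^ 2 + b ^ 2) - 2 * s t = 0) ->
  (forall t, s 0 <= s t) ->
  forall t, s t = - a + 2 * a * sn2 a b t.
Proof.
intros Ha Hab Hs Hc Hcw Hw Hcb Hnl Hmin.
set (m := a ^ 2 + b ^ 2) in *.
assert (Hw0 : forall t, 1 + m - 2 * s t <> 0).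
{ intros t0 Ht0; apply Hnl.
  apply (gronwall_zero _ (fun t => 2 * c t * (1 + m - 2 * s t)) (1 + m)) with (t0 := t0);
    [|exact Hw| |exact Ht0].
  - intro t. derive. ring.
  - intro t; specialize (Hw t); specialize (Hcb t).
    rewrite Rabs_mult, (Rabs_right (1 + m - 2 * s t)) by lra.
    apply Rmult_le_compat_r; [lra|]; apply Rabs_le.
    generalize (pow2_ge_0 (c t - 1)) (pow2_ge_0 (c t + 1)); lra. }
assert (Hsa : forall t, - a <= s t <= a).
{ intro t; specialize (Hw t); specialize (Hcw t).
  assert (0 <= c t ^ 2 * (1 + m - 2 * s t)) by (apply Rmult_le_pos; [nra|lra]).
  nra. }
assert (Hc0 : c 0 = 0).
{ assert (D := derive_at_minimum s _ 0 Hs Hmin); simpl in D.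
  specialize (Hw0 0). destruct (Rmult_integral _ _ D); [lra|contradiction]. }
assert (Hs0 : s 0 = - a).
{ assert (E := Hcw 0); rewrite Hc0 in E.
  destruct (Req_dec (s 0) (- a)) as [H|H]; [exact H|].
  assert (Ea : s 0 = a) by nra.
  assert (Hca : forall t, s t = a) by (intro t; specialize (Hmin t); specialize (Hsa t); lra).
  assert (Hcz : forall t, c t = 0).
  { intro t; specialize (Hcw t); rewrite (Hca t) in Hcw; specialize (Hw0 t); rewrite (Hca t) in Hw0.
    assert (P : c t * c t * (1 + m - 2 * a) = 0) by lra.
    destruct (Rmult_integral _ _ P) as [Q|Q]; [|contradiction].
    now destruct (Rmult_integral _ _ Q). }
  assert (D : is_derive c 0 0) by (apply (is_derive_ext (fun _ => 0)); [now intro|apply (is_derive_const 0 0)]).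
  generalize (is_derive_unique _ _ _ (Hc 0)); rewrite (is_derive_unique _ _ _ D), Hcz, Hca; lra. }
destruct (sn2_second_derivative (par_k a b) (par_k_bounds a b Ha)) as [w [w0 [Hw1 Hw2]]].
set (om := par_omega a b); set (k := par_k a b) in *.
assert (Hom := par_omega_sqr a b Ha); fold om in Hom.
assert (Hok := par_omega_k_sqr a b Ha); fold om k in Hok.
assert (Hsnb := sn2_bounds a b Ha).
(* s and its claimed value solve the same second order equation, with the same data at 0 *)
assert (HD : forall t, is_derive (fun t => s t - (- a + 2 * a * sn2 a b t)) t
   (- c t * (1 + m - 2 * s t) - 2 * a * om * w (om * t))).
{ intro t. unfold sn2; fold om k.
  set (f := fun u => jacobi_sn u k ^ 2) in Hw1.
  apply (is_derive_ext (fun t => s t - (- a + 2 * a * f (om * t)))); [reflexivity|].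
  derive. ring. }
set (D := fun t => s t - (- a + 2 * a * sn2 a b t)) in HD.
set (F := fun t => - c t * (1 + m - 2 * s t) - 2 * a * om * w (om * t)).
assert (HF : forall t, is_derive F t
   ((3 * (s t + (- a + 2 * a * sn2 a b t)) - (1 + m)) * D t)).
{ intro t; unfold F, D. derive. unfold sn2; fold om k.
  set (u := jacobi_sn (om * t) k ^ 2).
  transitivity (- s t * (1 + m - 2 * s t) - c t ^ 2 * (1 + m - 2 * s t)
     - a * (4 * om ^ 2) * (1 - 2 * u)
     + 4 * a * (om ^ 2 * k ^ 2) * (2 * u - 3 * u ^ 2)); [ring|].
  rewrite Hcw, Hok, Hom; unfold m; ring. }
assert (HE : forall t, D t ^ 2 + F t ^ 2 = 0).
{ apply (gronwall_zero _ (fun t => 2 * D t * F t *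
     (1 + (3 * (s t + (- a + 2 * a * sn2 a b t)) - (1 + m)))) (2 + m + 6 * a)) with (t0 := 0).
  - intro t. derive. unfold F; ring.
  - intro t; nra.
  - intro t; rewrite Rabs_mult, Rmult_comm.
    apply Rmult_le_compat; try apply Rabs_pos.
    + specialize (Hsa t); specialize (Hsnb t).
      assert (0 <= a * sn2 a b t <= a) by nra. apply Rabs_le; lra.
    + apply Rabs_le; generalize (pow2_ge_0 (D t - F t)) (pow2_ge_0 (D t + F t)); lra.
  - unfold D, F, sn2; rewrite Hc0, Hs0, !Rmult_0_r, w0.
    fold k; unfold jacobi_sn.
    rewrite (proj1 (am_solution k (par_k_bounds a b Ha))), sin_0; ring. }
intro t; specialize (HE t).
assert (D t = 0) by nra. unfold D in *; lra.
Qed.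

(** * Polar angles *)

(** In the frame that turns with the angle [phi], a point whose angular speed is
    [phi'] keeps its direction: the coordinates of its unit position vector have
    zero derivative. *)
Lemma polar_transport (X Y U V phi dphi : R -> R) (s t : R) :
  (forall u, is_derive X u (U u)) -> (forall u, is_derive Y u (V u)) ->
  (forall u, is_derive phi u (dphi u)) ->
  (forall u, Rmin s t <= u <= Rmax s t ->
     0 < X u ^ 2 + Y u ^ 2 /\
     dphi u = (X u * V u - Y u * U u) / (X u ^ 2 + Y u ^ 2)) ->
  let rho u := sqrt (X u ^ 2 + Y u ^ 2) in
  let d := phi t - phi s in
  X t / rho t = cos d * (X s / rho s) - sin d * (Y s / rho s) /\
  Y t / rho t = sin d * (X s / rho s) + cos d * (Y s / rho s).
Proof.
intros HX HY Hphi Hpos rho d.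
assert (Hrho : forall u, Rmin s t <= u <= Rmax s t -> 0 < rho u /\ rho u ^ 2 = X u ^ 2 + Y u ^ 2).
{ intros u Hu; destruct (Hpos u Hu) as [H _]; split; [now apply sqrt_lt_R0|].
  apply pow2_sqrt; lra. }
assert (Hdrho : forall u, Rmin s t <= u <= Rmax s t ->
   is_derive rho u ((X u * U u + Y u * V u) / rho u)).
{ intros u Hu; destruct (Hpos u Hu) as [H _]; destruct (Hrho u Hu) as [H' _].
  unfold rho in *; derive.
  match goal with |- context [/ (2 * sqrt ?x)] =>
    replace x with (X u ^ 2 + Y u ^ 2) by ring end.
  field; lra. }
assert (P : (cos (phi t) * X t + sin (phi t) * Y t) / rho t =
            (cos (phi s) * X s + sin (phi s) * Y s) / rho s).
{ apply (constant_between (fun u => (cos (phi u) * X u + sin (phi u) * Y u) / rho u)).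
  intros u Hu; destruct (Hpos u Hu) as [H E]; destruct (Hrho u Hu) as [H' E'].
  specialize (Hdrho u Hu).
  derive.
  rewrite E, <- E'.
  transitivity ((cos (phi u) * (U u * rho u ^ 2 + Y u * (X u * V u - Y u * U u)
                                - X u * (X u * U u + Y u * V u))
               + sin (phi u) * (V u * rho u ^ 2 - X u * (X u * V u - Y u * U u)
                                - Y u * (X u * U u + Y u * V u))) / rho u ^ 3);
    [field; lra|rewrite E'; field; lra]. }
assert (Q : (cos (phi t) * Y t - sin (phi t) * X t) / rho t =
            (cos (phi s) * Y s - sin (phi s) * X s) / rho s).
{ apply (constant_between (fun u => (cos (phi u) * Y u - sin (phi u) * X u) / rho u)).
  intros u Hu; destruct (Hpos u Hu) as [H E]; destruct (Hrho u Hu) as [H' E'].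
  specialize (Hdrho u Hu).
  derive.
  rewrite E, <- E'.
  transitivity ((cos (phi u) * (V u * rho u ^ 2 - X u * (X u * V u - Y u * U u)
                                - Y u * (X u * U u + Y u * V u))
               - sin (phi u) * (U u * rho u ^ 2 + Y u * (X u * V u - Y u * U u)
                                - X u * (X u * U u + Y u * V u))) / rho u ^ 3);
    [field; lra|rewrite E'; field; lra]. }
assert (Hst : Rmin s t <= s <= Rmax s t /\ Rmin s t <= t <= Rmax s t).
{ unfold Rmin, Rmax; destruct (Rle_dec s t); lra. }
destruct (Hrho s (proj1 Hst)) as [Hs _]; destruct (Hrho t (proj2 Hst)) as [Ht _].
assert (SC := sin2_cos2 (phi t)); unfold Rsqr in SC.
unfold d; rewrite cos_minus, sin_minus.
set (ct := cos (phi t)) in *; set (st := sin (phi t)) in *.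
split.
- transitivity (ct * ((ct * X t + st * Y t) / rho t) - st * ((ct * Y t - st * X t) / rho t)).
  + transitivity ((st * st + ct * ct) * X t / rho t); [rewrite SC|]; field; lra.
  + rewrite P, Q; field; lra.
- transitivity (st * ((ct * X t + st * Y t) / rho t) + ct * ((ct * Y t - st * X t) / rho t)).
  + transitivity ((st * st + ct * ct) * Y t / rho t); [rewrite SC|]; field; lra.
  + rewrite P, Q; field; lra.
Qed.

(** By the intermediate value theorem, a function that is not constant takes a
    value that differs from [f s] by less than [1], and the cosine of the
    difference would be [1]. *)
Lemma continuous_multiple_of_2PI (f : R -> R) (s t : R) :
  (forall u, Rmin s t <= u <= Rmax s t -> continuous f u) ->
  (forall u, Rmin s t <= u <= Rmax s t -> cos (f u) = 1) -> f t = f s.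
Proof.
assert (main : forall (g : R -> R) s t, s < t ->
  (forall u, s <= u <= t -> continuous g u) ->
  (forall u, s <= u <= t -> cos (g u) = 1) -> ~ g s < g t).
{ clear f s t; intros g s t Hst Hc H1 Hlt.
  assert (HPI := PI_RGT_0).
  set (m := Rmin ((g t - g s) / 2) 1).
  assert (Hm : 0 < m <= 1 /\ m < g t - g s).
  { unfold m, Rmin; destruct (Rle_dec _ _); lra. }
  destruct (IVT_interv (fun u => g u - (g s + m)) s t) as [z [Hz Ez]]; try lra.
  - intros u Hu; apply continuity_pt_filterlim.
    apply (continuous_minus g (fun _ => g s + m)); [now apply Hc|apply continuous_const].
  - assert (Hz1 := H1 z Hz); assert (Hs1 := H1 s ltac:(lra)).
    replace (g z) with (g s + m) in Hz1 by lra.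
    assert (Hs0 : sin (g s) = 0).
    { generalize (sin2_cos2 (g s)); unfold Rsqr; rewrite Hs1; nra. }
    rewrite cos_plus, Hs0, Hs1 in Hz1.
    replace m with (2 * (m / 2)) in Hz1 by field.
    rewrite cos_2a_sin in Hz1.
    assert (0 < sin (m / 2)).
    { generalize PI2_1; intro; apply sin_gt_0; lra. }
    nra. }
assert (main2 : forall (g : R -> R) s t, s < t ->
  (forall u, s <= u <= t -> continuous g u) ->
  (forall u, s <= u <= t -> cos (g u) = 1) -> g t = g s).
{ intros g a b Hab Hc H1; assert (A := main g a b Hab Hc H1).
  assert (B := main (fun u => - g u) a b Hab).
  destruct (Rtotal_order (g a) (g b)) as [H|[H|H]]; [contradiction|now symmetry|].
  exfalso; apply B; [| |lra].
  - intros u Hu; apply (continuous_opp g), Hc, Hu.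
  - intros u Hu; rewrite cos_neg; auto. }
intros Hc H1; destruct (Rtotal_order s t) as [H|[->|H]]; [|reflexivity|].
- rewrite Rmin_left, Rmax_right in * by lra; auto.
- rewrite Rmin_right, Rmax_left in * by lra; symmetry; auto.
Qed.

Lemma polar_angle_increment (X Y U V phi dphi rho theta : R -> R) (s t : R) :
  (forall u, is_derive X u (U u)) -> (forall u, is_derive Y u (V u)) ->
  (forall u, is_derive phi u (dphi u)) ->
  (forall u, 0 < X u ^ 2 + Y u ^ 2 ->
     dphi u = (X u * V u - Y u * U u) / (X u ^ 2 + Y u ^ 2)) ->
  (forall u, X u = rho u * cos (theta u)) ->
  (forall u, Y u = rho u * sin (theta u)) ->
  angle_determination rho theta s t ->
  theta t - theta s = phi t - phi s.
Proof.
intros HX HY Hphi Hrate EX EY Hang.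
assert (Hn : forall u, X u ^ 2 + Y u ^ 2 = rho u ^ 2).
{ intro u; rewrite EX, EY; generalize (sin2_cos2 (theta u)); unfold Rsqr.
  intro SC; transitivity (rho u ^ 2 * (sin (theta u) * sin (theta u) + cos (theta u) * cos (theta u)));
    [ring|rewrite SC; ring]. }
assert (Hst : Rmin s t <= s <= Rmax s t /\ Rmin s t <= t <= Rmax s t).
{ unfold Rmin, Rmax; destruct (Rle_dec s t); lra. }
assert (Hcos : forall u, Rmin s t <= u <= Rmax s t ->
   cos (theta u - phi u - (theta s - phi s)) = 1).
{ intros u Hu.
  destruct (polar_transport X Y U V phi dphi s u HX HY Hphi) as [TX TY].
  { intros v Hv.
    assert (Hv' : Rmin s t <= v <= Rmax s t).
    { revert Hu Hv; unfold Rmin, Rmax; destruct (Rle_dec s t), (Rle_dec s u); lra. }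
    assert (P : 0 < X v ^ 2 + Y v ^ 2).
    { rewrite Hn; apply pow_lt, Hang, Hv'. }
    split; [exact P|now apply Hrate]. }
  assert (Hr : forall v, Rmin s t <= v <= Rmax s t -> 0 < rho v /\ sqrt (X v ^ 2 + Y v ^ 2) = rho v).
  { intros v Hv; destruct (Hang v Hv) as [H _]; split; [exact H|].
    rewrite Hn; apply sqrt_pow2; lra. }
  destruct (Hr u Hu) as [Ru Eu]; destruct (Hr s (proj1 Hst)) as [Rs Es].
  rewrite Eu, Es in TX, TY.
  replace (X u / rho u) with (cos (theta u)) in TX by (rewrite EX; field; lra).
  replace (X s / rho s) with (cos (theta s)) in TX, TY by (rewrite EX; field; lra).
  replace (Y u / rho u) with (sin (theta u)) in TY by (rewrite EY; field; lra).
  replace (Y s / rho s) with (sin (theta s)) in TX, TY by (rewrite EY; field; lra).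
  replace (theta u - phi u - (theta s - phi s))
    with (theta u - (theta s + (phi u - phi s))) by ring.
  rewrite cos_minus, TX, TY, cos_plus, sin_plus.
  set (cd := cos (phi u - phi s)); set (sd := sin (phi u - phi s)).
  assert (E1 : cd * cd = 1 - sd * sd).
  { generalize (sin2_cos2 (phi u - phi s)); unfold Rsqr; fold cd sd; lra. }
  assert (E2 : cos (theta s) * cos (theta s) = 1 - sin (theta s) * sin (theta s)).
  { generalize (sin2_cos2 (theta s)); unfold Rsqr; lra. }
  ring [E1 E2]. }
assert (E : theta t - phi t - (theta s - phi s) = theta s - phi s - (theta s - phi s)).
{ apply (continuous_multiple_of_2PI (fun u => theta u - phi u - (theta s - phi s)) s t); [|exact Hcos].
  intros u Hu; apply (continuous_minus (fun u => theta u - phi u) (fun _ => theta s - phi s));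
    [|apply continuous_const].
  apply (continuous_minus theta phi); [apply Hang, Hu|].
  apply (ex_derive_continuous phi); eexists; apply Hphi. }
lra.
Qed.

Lemma angle_of_unit (x y : R) : x ^ 2 + y ^ 2 = 1 -> exists phi, cos phi = x /\ sin phi = y.
Proof.
intro H; assert (Hx : -1 <= x <= 1) by (split; nra).
assert (Hs : sqrt (1 - x²) = Rabs y).
{ rewrite <- sqrt_Rsqr_abs; f_equal; unfold Rsqr; lra. }
destruct (Rle_or_lt 0 y).
- exists (acos x); rewrite cos_acos, sin_acos, Hs, Rabs_right by lra; auto.
- exists (- acos x); rewrite cos_neg, sin_neg, cos_acos, sin_acos, Hs, Rabs_left by lra.
  split; lra.
Qed.

(** * Motion orthogonal to the axis *)

(** [(X, Y)] is the position of the front wheel orthogonally to the axis, [(U, V)]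
    its velocity, [s = x' . p], [c = v . p] and [q = |p|].  The equations for [U]
    and [V] are the Lorentz force of the magnetic field [K]; the last three
    fields express the squared distance to the axis, the radial motion and the
    angular momentum by [s] and [s']. *)
Record planar_motion (q a b : R) (X Y U V s c : R -> R) : Prop := {
  pm_X : forall t, is_derive X t (U t);
  pm_Y : forall t, is_derive Y t (V t);
  pm_U : forall t, is_derive U t (s t * X t - b / q * V t);
  pm_V : forall t, is_derive V t (s t * Y t + b / q * U t);
  pm_s : forall t, is_derive s t (- c t * (1 + q ^ 2 - 2 * s t));
  pm_norm : forall t, q ^ 2 * (X t ^ 2 + Y t ^ 2) = q ^ 2 + a ^ 2 / q ^ 2 - 2 * s t;
  pm_radial : forall t, q ^ 2 * (X t * U t + Y t * V t) = c t * (1 + q ^ 2 - 2 * s t);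
  pm_angular : forall t, q ^ 3 * (X t * V t - Y t * U t) = b * (q ^ 2 - s t) }.

(** Position and velocity solve a linear differential equation with [T]-periodic
    coefficients that commutes with rotations.  A rotation that carries the
    position at [0] to the position at [T] also carries the velocity, whose
    scalar product and determinant with the position are the same at both
    times.  Hence it carries the whole motion to the motion one period later,
    even where the track crosses the axis and has no polar
    angle. *)
Lemma planar_motion_period (q a b T : R) (X Y U V s c : R -> R) :
  planar_motion q a b X Y U V s c -> 0 < q ->
  (forall t, - a <= s t <= a) -> (forall t, s (t + T) = s t) ->
  0 < X 0 ^ 2 + Y 0 ^ 2 ->
  forall phi,
  X T = cos phi * X 0 - sin phi * Y 0 -> Y T = sin phi * X 0 + cos phi * Y 0 ->
  forall t, X (t + T) = cos phi * X t - sin phi * Y t /\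
            Y (t + T) = sin phi * X t + cos phi * Y t.
Proof.
intros [HX HY HU HV Hs Hnorm Hrad Hang] Hq Hsb Hper H0 phi EX EY.
set (C := cos phi) in *; set (S := sin phi) in *.
assert (SC : C * C = 1 - S * S).
{ generalize (sin2_cos2 phi); unfold Rsqr; fold C S; lra. }
assert (Hcw : c T * (1 + q ^ 2 - 2 * s T) = c 0 * (1 + q ^ 2 - 2 * s 0)).
{ assert (D : is_derive (fun t => s (t + T)) 0 (- c T * (1 + q ^ 2 - 2 * s T))).
  { derive. rewrite Rplus_0_l; ring. }
  assert (D' : is_derive (fun t => s (t + T)) 0 (- c 0 * (1 + q ^ 2 - 2 * s 0))).
  { apply (is_derive_ext s); [intro; symmetry; apply Hper|apply Hs]. }
  apply is_derive_unique in D; apply is_derive_unique in D'. lra. }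
assert (HsT : s T = s 0) by (rewrite <- (Hper 0); f_equal; ring).
set (D1 := fun t => X (t + T) - (C * X t - S * Y t)).
set (D2 := fun t => Y (t + T) - (S * X t + C * Y t)).
set (F1 := fun t => U (t + T) - (C * U t - S * V t)).
set (F2 := fun t => V (t + T) - (S * U t + C * V t)).
assert (HD1 : forall t, is_derive D1 t (F1 t)) by (intro t; unfold D1, F1; derive; ring).
assert (HD2 : forall t, is_derive D2 t (F2 t)) by (intro t; unfold D2, F2; derive; ring).
assert (HF1 : forall t, is_derive F1 t (s t * D1 t - b / q * F2 t)).
{ intro t; unfold D1, F1, F2; derive; rewrite Hper; ring. }
assert (HF2 : forall t, is_derive F2 t (s t * D2 t + b / q * F1 t)).
{ intro t; unfold D2, F1, F2; derive; rewrite Hper; ring. }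
(* X T * F1 0 + Y T * F2 0 and X T * F2 0 - Y T * F1 0 compare the products of
   position and velocity at T and 0 *)
assert (HF0 : F1 0 = 0 /\ F2 0 = 0).
{ assert (Hr : X T * U T + Y T * V T = X 0 * U 0 + Y 0 * V 0).
  { apply (Rmult_eq_reg_l (q ^ 2)); [rewrite !Hrad; exact Hcw|apply pow_nonzero; lra]. }
  assert (Ha : X T * V T - Y T * U T = X 0 * V 0 - Y 0 * U 0).
  { apply (Rmult_eq_reg_l (q ^ 3)); [rewrite !Hang, HsT; reflexivity|apply pow_nonzero; lra]. }
  assert (E1 : X T * F1 0 + Y T * F2 0 = 0).
  { unfold F1, F2; rewrite Rplus_0_l.
    transitivity (X T * U T + Y T * V T - (X 0 * U 0 + Y 0 * V 0)); [|lra].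
    rewrite EX, EY; ring [SC]. }
  assert (E2 : X T * F2 0 - Y T * F1 0 = 0).
  { unfold F1, F2; rewrite Rplus_0_l.
    transitivity (X T * V T - Y T * U T - (X 0 * V 0 - Y 0 * U 0)); [|lra].
    rewrite EX, EY; ring [SC]. }
  assert (N : X T ^ 2 + Y T ^ 2 = X 0 ^ 2 + Y 0 ^ 2) by (rewrite EX, EY; ring [SC]).
  assert (P : (X 0 ^ 2 + Y 0 ^ 2) * F1 0 = 0).
  { rewrite <- N. transitivity (X T * (X T * F1 0 + Y T * F2 0) - Y T * (X T * F2 0 - Y T * F1 0));
     [ring|rewrite E1, E2; ring]. }
  assert (Q : (X 0 ^ 2 + Y 0 ^ 2) * F2 0 = 0).
  { rewrite <- N. transitivity (Y T * (X T * F1 0 + Y T * F2 0) + X T * (X T * F2 0 - Y T * F1 0));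
     [ring|rewrite E1, E2; ring]. }
  split; [apply Rmult_integral in P|apply Rmult_integral in Q]; lra. }
assert (HE : forall t, D1 t ^ 2 + D2 t ^ 2 + F1 t ^ 2 + F2 t ^ 2 = 0).
{ apply (gronwall_zero _ (fun t => (1 + s t) * (2 * (D1 t * F1 t + D2 t * F2 t))) (1 + a)) with (t0 := 0).
  - intro t. derive. ring.
  - intro t; nra.
  - intro t; rewrite Rabs_mult; apply Rmult_le_compat; try apply Rabs_pos.
    + specialize (Hsb t); apply Rabs_le; lra.
    + apply Rabs_le; generalize (pow2_ge_0 (D1 t - F1 t)) (pow2_ge_0 (D1 t + F1 t))
       (pow2_ge_0 (D2 t - F2 t)) (pow2_ge_0 (D2 t + F2 t)); lra.
  - destruct HF0 as [-> ->]; unfold D1, D2; rewrite Rplus_0_l, EX, EY; ring. }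
intro t; specialize (HE t).
assert (D1 t = 0 /\ D2 t = 0) by (split; nra).
unfold D1, D2 in *; lra.
Qed.

Lemma planar_motion_rotation (q a b T : R) (X Y U V s c : R -> R) :
  planar_motion q a b X Y U V s c -> 0 < q ->
  (forall t, - a <= s t <= a) -> (forall t, s (t + T) = s t) ->
  0 < X 0 ^ 2 + Y 0 ^ 2 ->
  exists phi, forall t, X (t + T) = cos phi * X t - sin phi * Y t /\
            Y (t + T) = sin phi * X t + cos phi * Y t.
Proof.
intros H Hq Hsb Hper H0.
assert (N : X T ^ 2 + Y T ^ 2 = X 0 ^ 2 + Y 0 ^ 2).
{ apply (Rmult_eq_reg_l (q ^ 2)); [|apply pow_nonzero; lra].
  rewrite !(pm_norm _ _ _ _ _ _ _ _ _ H), <- (Hper 0), Rplus_0_l; reflexivity. }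
set (W := X 0 ^ 2 + Y 0 ^ 2) in *.
destruct (angle_of_unit ((X 0 * X T + Y 0 * Y T) / W) ((X 0 * Y T - Y 0 * X T) / W))
  as [phi [Ec Es]].
{ transitivity ((X T ^ 2 + Y T ^ 2) * W / W ^ 2); [unfold W; field|rewrite N; field]; unfold W in *; lra. }
exists phi; apply (planar_motion_period q a b T X Y U V s c); auto; rewrite Ec, Es.
- transitivity (X T * W / W); [|unfold W]; field; unfold W in *; lra.
- transitivity (Y T * W / W); [|unfold W]; field; unfold W in *; lra.
Qed.

(** * Vectors and frames of the space *)

Lemma plus_coords (u1 u2 u3 v1 v2 v3 : R) :
  plus ((u1, u2, u3) : vec3) (v1, v2, v3) = (u1 + v1, u2 + v2, u3 + v3).
Proof. reflexivity. Qed.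

Lemma minus_coords (u1 u2 u3 v1 v2 v3 : R) :
  minus ((u1, u2, u3) : vec3) (v1, v2, v3) = (u1 - v1, u2 - v2, u3 - v3).
Proof. reflexivity. Qed.

Lemma scal_coords (c u1 u2 u3 : R) :
  scal c ((u1, u2, u3) : vec3) = (c * u1, c * u2, c * u3).
Proof. reflexivity. Qed.

Ltac vec_unfold :=
  repeat match goal with u : vec3 |- _ => destruct u as [[? ?] ?] end;
  unfold triple in *; simpl cross in *;
  rewrite ?scal_coords, ?plus_coords, ?minus_coords in *;
  simpl cross in *; simpl dot in *;
  rewrite ?scal_coords, ?plus_coords, ?minus_coords in *.

Ltac vec_eq :=
  apply (f_equal2 pair); [apply (f_equal2 pair)|];
  match goal with |- ?x = ?y => change (@eq R x y) end.

Ltac vec := intros; vec_unfold; first [ring | vec_eq; ring].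

Lemma dot_comm (u v : vec3) : dot u v = dot v u.
Proof. vec. Qed.
Lemma dot_plus_l (u v w : vec3) : dot (plus u v) w = dot u w + dot v w.
Proof. vec. Qed.
Lemma dot_minus_l (u v w : vec3) : dot (minus u v) w = dot u w - dot v w.
Proof. vec. Qed.
Lemma dot_scal_l (c : R) (u w : vec3) : dot (scal c u) w = c * dot u w.
Proof. vec. Qed.
Lemma dot_plus_r (u v w : vec3) : dot w (plus u v) = dot w u + dot w v.
Proof. vec. Qed.
Lemma dot_minus_r (u v w : vec3) : dot w (minus u v) = dot w u - dot w v.
Proof. vec. Qed.
Lemma dot_scal_r (c : R) (u w : vec3) : dot w (scal c u) = c * dot w u.
Proof. vec. Qed.

Ltac dot_expand :=
  repeat first [ rewrite dot_plus_l | rewrite dot_minus_l | rewrite dot_scal_l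
               | rewrite dot_plus_r | rewrite dot_minus_r | rewrite dot_scal_r ].

Lemma dot_cross_self (u v : vec3) : dot u (cross u v) = 0 /\ dot v (cross u v) = 0.
Proof. split; vec. Qed.

Lemma dot_cross_cross (u v w z : vec3) :
  dot (cross u v) (cross w z) = dot u w * dot v z - dot u z * dot v w.
Proof. vec. Qed.

Lemma cross_cross (u v w : vec3) :
  cross u (cross v w) = minus (scal (dot u w) v) (scal (dot u v) w).
Proof. vec. Qed.

Lemma cross_cross_l (u v w : vec3) :
  cross (cross u v) w = minus (scal (dot u w) v) (scal (dot v w) u).
Proof. vec. Qed.

Lemma minus_scal_1_0 (u w : vec3) : minus (scal 1 u) (scal 0 w) = u.
Proof. vec. Qed.

Lemma dot_self_nonneg (u : vec3) : 0 <= dot u u.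
Proof. vec_unfold; nra. Qed.

Lemma dot_self_zero (u : vec3) : dot u u = 0 -> u = (0, 0, 0).
Proof. intro H; vec_unfold; vec_eq; nra. Qed.

Lemma vnorm_sqr (u : vec3) : vnorm u ^ 2 = dot u u.
Proof. apply pow2_sqrt, dot_self_nonneg. Qed.

Lemma minus_zero_eq (u w : vec3) : minus u w = (0, 0, 0) -> u = w.
Proof. intro H; vec_unfold; injection H; intros; vec_eq; lra. Qed.

Lemma on_line_refl (u d : vec3) : on_line u d u.
Proof. exists 0; vec_unfold; vec_eq; ring. Qed.

(** Up to terms that vanish, [|d| ^ 2 |e x f| ^ 2] is the squared triple
    product. *)
Lemma orthogonal_to_basis (d e f : vec3) :
  dot (cross e f) (cross e f) <> 0 ->
  dot d e = 0 -> dot d f = 0 -> triple d e f = 0 -> d = (0, 0, 0).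
Proof.
intros Hef He Hf Hd.
assert (G : dot d d * dot (cross e f) (cross e f) = triple d e f ^ 2
   + dot d e * (dot d e * dot f f - dot d f * dot e f)
   + dot d f * (dot d f * dot e e - dot d e * dot e f)) by vec.
rewrite He, Hf, Hd in G.
assert (G0 : dot d d * dot (cross e f) (cross e f) = 0) by (rewrite G; ring).
apply dot_self_zero; destruct (Rmult_integral _ _ G0); [assumption|contradiction].
Qed.

Lemma is_derive_dot (x : R -> vec3) (t : R) (l e : vec3) :
  is_derive x t l -> is_derive (fun t => dot (x t) e) t (dot l e).
Proof.
intro H.
assert (H12 : is_derive (fun t => fst (x t)) t (fst l)).
{ apply (filterdiff_comp' x fst t _ fst H), filterdiff_linear, is_linear_fst. }
assert (H3 : is_derive (fun t => snd (x t)) t (snd l)).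
{ apply (filterdiff_comp' x snd t _ snd H), filterdiff_linear, is_linear_snd. }
assert (H1 : is_derive (fun t => fst (fst (x t))) t (fst (fst l))).
{ apply (filterdiff_comp' (fun t => fst (x t)) fst t _ fst H12), filterdiff_linear, is_linear_fst. }
assert (H2 : is_derive (fun t => snd (fst (x t))) t (snd (fst l))).
{ apply (filterdiff_comp' (fun t => fst (x t)) snd t _ snd H12), filterdiff_linear, is_linear_snd. }
destruct e as [[e1 e2] e3].
apply (is_derive_ext (fun t => fst (fst (x t)) * e1 + snd (fst (x t)) * e2 + snd (x t) * e3)).
{ intro u; destruct (x u) as [[? ?] ?]; reflexivity. }
assert (lin : forall f1 f2 f3 : R -> R, forall l1 l2 l3 : R,
  is_derive f1 t l1 -> is_derive f2 t l2 -> is_derive f3 t l3 ->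
  is_derive (fun t => f1 t * e1 + f2 t * e2 + f3 t * e3) t (l1 * e1 + l2 * e2 + l3 * e3)).
{ intros; derive; ring. }
destruct l as [[l1 l2] l3]; now apply lin.
Qed.

Lemma vderive_eq (x : R -> vec3) (t : R) (l : vec3) : is_derive x t l -> vderive x t = l.
Proof.
intro H.
assert (E : forall e, Derive (fun t => dot (x t) e) t = dot l e).
{ intro e; now apply is_derive_unique, is_derive_dot. }
destruct l as [[l1 l2] l3]; unfold vderive; vec_eq.
- rewrite (Derive_ext _ (fun t => dot (x t) (1, 0, 0))), E; simpl; [ring|].
  intro u; destruct (x u) as [[? ?] ?]; simpl; ring.
- rewrite (Derive_ext _ (fun t => dot (x t) (0, 1, 0))), E; simpl; [ring|].
  intro u; destruct (x u) as [[? ?] ?]; simpl; ring.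
- rewrite (Derive_ext _ (fun t => dot (x t) (0, 0, 1))), E; simpl; [ring|].
  intro u; destruct (x u) as [[? ?] ?]; simpl; ring.
Qed.

Section Frame.
Variables p e1 : vec3.
Hypothesis Hp : p <> (0, 0, 0).
Hypothesis He1 : vnorm e1 = 1.
Hypothesis He1p : dot e1 p = 0.

Definition axis_unit : vec3 := scal (/ vnorm p) p.
Definition normal_unit : vec3 := cross axis_unit e1.
Notation e3 := axis_unit.
Notation e2 := normal_unit.
Notation q := (vnorm p).

Lemma vnorm_p_pos : 0 < q.
Proof.
apply sqrt_lt_R0; destruct (dot_self_nonneg p) as [H|H]; [exact H|].
now destruct Hp; apply dot_self_zero.
Qed.

Lemma p_axis_unit : p = scal q e3.
Proof.
assert (Hq := vnorm_p_pos); unfold axis_unit; rewrite scal_assoc.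
unfold mult; simpl; rewrite Rinv_r by lra; symmetry; apply (scal_one p).
Qed.

Lemma frame_dots :
  dot e1 e1 = 1 /\ dot e2 e2 = 1 /\ dot e3 e3 = 1 /\
  dot e1 e2 = 0 /\ dot e1 e3 = 0 /\ dot e2 e3 = 0.
Proof.
assert (Hq := vnorm_p_pos).
assert (E11 : dot e1 e1 = 1) by (rewrite <- vnorm_sqr, He1; ring).
assert (E33 : dot e3 e3 = 1).
{ unfold axis_unit; rewrite dot_scal_l, dot_scal_r, <- vnorm_sqr; field; lra. }
assert (E13 : dot e1 e3 = 0) by (unfold axis_unit; rewrite dot_scal_r, He1p; ring).
destruct (dot_cross_self e3 e1) as [E23 E12].
repeat split; trivial.
- unfold normal_unit; rewrite dot_cross_cross, E11, E33, (dot_comm e3 e1), E13; ring.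
- unfold normal_unit; now rewrite dot_comm.
Qed.

Lemma frame_cross : cross e1 e2 = e3 /\ cross e2 e3 = e1.
Proof.
destruct frame_dots as (E11 & E22 & E33 & E12 & E13 & E23).
split; unfold normal_unit.
- rewrite cross_cross, E11, E13; apply minus_scal_1_0.
- rewrite cross_cross_l, E33, E13; apply minus_scal_1_0.
Qed.

Lemma frame_ext (u w : vec3) :
  dot u e1 = dot w e1 -> dot u e2 = dot w e2 -> dot u e3 = dot w e3 -> u = w.
Proof.
intros H1 H2 H3; apply minus_zero_eq.
destruct frame_dots as (E11 & E22 & E33 & E12 & E13 & E23).
apply (orthogonal_to_basis _ e1 e2).
- rewrite dot_cross_cross, E11, E22, E12; lra.
- rewrite dot_minus_l; lra.
- rewrite dot_minus_l; lra.
- unfold triple; rewrite (proj1 frame_cross), dot_minus_l; lra.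
Qed.

Lemma frame_decomposition (u : vec3) :
  u = plus (plus (scal (dot u e1) e1) (scal (dot u e2) e2)) (scal (dot u e3) e3).
Proof.
destruct frame_dots as (E11 & E22 & E33 & E12 & E13 & E23).
apply frame_ext; dot_expand; rewrite ?(dot_comm e2 e1), ?(dot_comm e3 e1), ?(dot_comm e3 e2),
  ?E11, ?E22, ?E33, ?E12, ?E13, ?E23; ring.
Qed.

Lemma frame_dot (u w : vec3) :
  dot u w = dot u e1 * dot w e1 + dot u e2 * dot w e2 + dot u e3 * dot w e3.
Proof.
rewrite (frame_decomposition u) at 1.
dot_expand; rewrite (dot_comm w e1), (dot_comm w e2), (dot_comm w e3); ring.
Qed.

Lemma frame_cross_coords (u w : vec3) :
  dot (cross u w) e1 = dot u e2 * dot w e3 - dot u e3 * dot w e2 /\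
  dot (cross u w) e2 = dot u e3 * dot w e1 - dot u e1 * dot w e3 /\
  dot (cross u w) e3 = dot u e1 * dot w e2 - dot u e2 * dot w e1.
Proof.
repeat split.
- rewrite <- (proj2 frame_cross) at 1; now rewrite dot_cross_cross.
- unfold normal_unit at 1; now rewrite dot_cross_cross.
- rewrite <- (proj1 frame_cross) at 1; now rewrite dot_cross_cross.
Qed.

Lemma frame_p : dot p e1 = 0 /\ dot p e2 = 0 /\ dot p e3 = q.
Proof.
destruct frame_dots as (E11 & E22 & E33 & E12 & E13 & E23).
rewrite p_axis_unit at 1 2 3; rewrite !dot_scal_l, E33, (dot_comm e3 e1), (dot_comm e3 e2), E13, E23.
repeat split; ring.
Qed.

End Frame.

Lemma exists_unit_normal (p : vec3) : p <> (0, 0, 0) -> exists e1, vnorm e1 = 1 /\ dot e1 p = 0.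
Proof.
destruct p as [[p1 p2] p3]; intros _.
destruct (Req_dec (p1 ^ 2 + p2 ^ 2) 0) as [H|H].
- exists (1, 0, 0); split.
  + unfold vnorm; simpl; replace (1 * 1 + 0 * 0 + 0 * 0) with 1 by ring; apply sqrt_1.
  + simpl; assert (p1 = 0) by nra; lra.
- assert (Hpos : 0 < p1 ^ 2 + p2 ^ 2) by nra.
  set (n := sqrt (p1 ^ 2 + p2 ^ 2)).
  assert (Hn : n * n = p1 ^ 2 + p2 ^ 2) by (apply sqrt_sqrt; lra).
  assert (0 < n) by now apply sqrt_lt_R0.
  exists (- p2 / n, p1 / n, 0); split.
  + unfold vnorm; simpl; rewrite <- sqrt_1; f_equal.
    transitivity ((p1 ^ 2 + p2 ^ 2) / (n * n)); [field; lra|rewrite Hn; field; lra].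
  + simpl; field; lra.
Qed.

(** * The equations of motion in an adapted frame *)

(** Components of [v] and [r] in an orthonormal frame whose third vector is
    [p / |p|], where the equations of bicycling geodesics become polynomial. *)

Section FrameSystem.
Variables (q a b : R) (v1 v2 v3 r1 r2 r3 s c : R -> R).
Hypothesis Hs : forall t, s t = q * (q + r3 t).
Hypothesis Hc : forall t, c t = q * v3 t.
Hypothesis Hq : 0 < q.
Hypothesis Hv1 : forall t, is_derive v1 t (r1 t - c t * v1 t).
Hypothesis Hv2 : forall t, is_derive v2 t (r2 t - c t * v2 t).
Hypothesis Hv3 : forall t, is_derive v3 t (q + r3 t - c t * v3 t).
Hypothesis Hr1 : forall t, is_derive r1 t (c t * r1 t - (1 - s t) * v1 t).
Hypothesis Hr2 : forall t, is_derive r2 t (c t * r2 t - (1 - s t) * v2 t).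
Hypothesis Hr3 : forall t, is_derive r3 t (c t * r3 t - (1 - s t) * v3 t).
Hypothesis Hv : forall t, v1 t * v1 t + v2 t * v2 t + v3 t * v3 t = 1.
Hypothesis Hrv : forall t, r1 t * v1 t + r2 t * v2 t + r3 t * v3 t = 0.
Hypothesis Hx : forall t, r1 t * r1 t + r2 t * r2 t + (q + r3 t) * (q + r3 t) = 1.
Hypothesis Hb : b = q * (v1 0 * r2 0 - v2 0 * r1 0).
Hypothesis Ha : a ^ 2 = q ^ 2 - b ^ 2.

Lemma frame_b_constant t : q * (v1 t * r2 t - v2 t * r1 t) = b.
Proof.
rewrite Hb.
apply (constant_between (fun t => q * (v1 t * r2 t - v2 t * r1 t)) 0 t); intros u _.
derive; ring.
Qed.

Lemma frame_r_norm t : r1 t * r1 t + r2 t * r2 t + r3 t * r3 t = 1 + q ^ 2 - 2 * s t.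
Proof. rewrite Hs; specialize (Hx t); lra. Qed.

Lemma frame_s_derive t : is_derive s t (- c t * (1 + q ^ 2 - 2 * s t)).
Proof.
apply (is_derive_ext (fun t => q * (q + r3 t))); [now intro|].
derive; rewrite Hc, Hs; ring.
Qed.

Lemma frame_c_derive t : is_derive c t (s t - c t ^ 2).
Proof.
apply (is_derive_ext (fun t => q * v3 t)); [now intro|].
derive; rewrite Hc, Hs; ring.
Qed.

(** The Gram determinant of [p], [v], [r] is [b ^ 2]. *)
Lemma frame_energy t : c t ^ 2 * (1 + q ^ 2 - 2 * s t) = a ^ 2 - s t ^ 2.
Proof.
rewrite Ha, <- (frame_b_constant t).
assert (E := frame_r_norm t).
assert (G : (v1 t * r2 t - v2 t * r1 t) ^ 2 =
  (1 - v3 t * v3 t) * (r1 t * r1 t + r2 t * r2 t) - (r3 t * v3 t) ^ 2).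
{ replace (1 - v3 t * v3 t) with (v1 t * v1 t + v2 t * v2 t) by (rewrite <- (Hv t); ring).
  replace (r3 t * v3 t) with (- (r1 t * v1 t + r2 t * v2 t)) by (generalize (Hrv t); lra).
  ring. }
replace (r1 t * r1 t + r2 t * r2 t) with (1 + q ^ 2 - 2 * s t - r3 t * r3 t) in G by lra.
rewrite Rpow_mult_distr, G, Hc, Hs; ring.
Qed.

(** The pair gives the vector [p x (r x v) / |p| ^ 2], orthogonal to [p]; its
    derivative is the part of the velocity orthogonal to [p], so that it is the
    position of the front wheel relative to an axis directed by [p]. *)
Lemma frame_planar_motion :
  planar_motion q a b (fun t => (r1 t * v3 t - r3 t * v1 t) / q)
                      (fun t => (r2 t * v3 t - r3 t * v2 t) / q) r1 r2 s c.
Proof.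
assert (En := frame_r_norm); assert (Eb := frame_b_constant).
split; intro t.
- derive. rewrite Hs, Hc; field; lra.
- derive. rewrite Hs, Hc; field; lra.
- replace (s t * ((r1 t * v3 t - r3 t * v1 t) / q) - b / q * r2 t)
    with (c t * r1 t - (1 - s t) * v1 t); [apply Hr1|].
  rewrite <- (Eb t).
  replace (1 - s t) with (r1 t * r1 t + r2 t * r2 t + r3 t * r3 t + q * r3 t)
    by (rewrite En, Hs; ring).
  assert (E : r2 t * v2 t = - (r1 t * v1 t) - r3 t * v3 t) by (generalize (Hrv t); lra).
  rewrite Hc, Hs; field_simplify_eq; [|lra].
  ring [E].
- replace (s t * ((r2 t * v3 t - r3 t * v2 t) / q) + b / q * r1 t)
    with (c t * r2 t - (1 - s t) * v2 t); [apply Hr2|].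
  rewrite <- (Eb t).
  replace (1 - s t) with (r1 t * r1 t + r2 t * r2 t + r3 t * r3 t + q * r3 t)
    by (rewrite En, Hs; ring).
  assert (E : r1 t * v1 t = - (r2 t * v2 t) - r3 t * v3 t) by (generalize (Hrv t); lra).
  rewrite Hc, Hs; field_simplify_eq; [|lra].
  ring [E].
- apply frame_s_derive.
- rewrite Ha, <- (Eb t).
  assert (L : (r1 t * v3 t - r3 t * v1 t) ^ 2 + (r2 t * v3 t - r3 t * v2 t) ^ 2
     + (v1 t * r2 t - v2 t * r1 t) ^ 2 = 1 + q ^ 2 - 2 * s t).
  { transitivity ((r1 t * r1 t + r2 t * r2 t + r3 t * r3 t)
      * (v1 t * v1 t + v2 t * v2 t + v3 t * v3 t) - (r1 t * v1 t + r2 t * v2 t + r3 t * v3 t) ^ 2);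
      [ring|rewrite Hv, Hrv, En; ring]. }
  transitivity (1 + q ^ 2 - 2 * s t - (v1 t * r2 t - v2 t * r1 t) ^ 2); [rewrite <- L|]; field; lra.
- rewrite Hc.
  transitivity (q * (v3 t * (r1 t * r1 t + r2 t * r2 t + r3 t * r3 t)
     - r3 t * (r1 t * v1 t + r2 t * v2 t + r3 t * v3 t))); [field; lra|].
  rewrite En, Hrv; ring.
- rewrite <- (Eb t), Hs.
  transitivity (- q ^ 2 * r3 t * (v1 t * r2 t - v2 t * r1 t)); [field; lra|ring].
Qed.

End FrameSystem.

(** * Bicycling geodesics *)

Section Geodesic.
Variables (x y : R -> vec3) (p : vec3) (r : R -> vec3) (a b : R).
Hypothesis Hgeo : bicycling_geodesic x y p r.
Hypothesis Hnonlin : ~ linear_track x.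
Hypothesis Hp : p <> (0, 0, 0).
Hypothesis Hb : b = geodesic_b x y p.
Hypothesis Ha : a ^ 2 = vnorm p ^ 2 - b ^ 2.
Hypothesis Ha0 : 0 <= a.
Hypothesis Hmax : forall t, curvature x t ^ 2 <= curvature x 0 ^ 2.

Notation q := (vnorm p).
Notation v := (frame_vector x y).

Let s (t : R) : R := dot (plus p (r t)) p.
Let c (t : R) : R := dot (v t) p.

Lemma front_derive t : is_derive x t (plus p (r t)).
Proof. exact (proj1 (proj2 Hgeo t)). Qed.

Lemma frame_vector_derive t :
  is_derive v t (minus (plus p (r t)) (scal (dot (v t) p) (v t))).
Proof. exact (proj1 (proj2 (proj2 Hgeo t))). Qed.

Lemma r_derive t :
  is_derive r t (minus (scal (dot (v t) p) (r t)) (scal (dot (r t) (plus (r t) p)) (v t))).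
Proof. exact (proj1 (proj2 (proj2 (proj2 Hgeo t)))). Qed.

Lemma r_orthogonal t : dot (r t) (v t) = 0.
Proof. exact (proj1 (proj2 (proj2 (proj2 (proj2 Hgeo t))))). Qed.

Lemma velocity_eq t : vderive x t = plus p (r t).
Proof. exact (vderive_eq x t _ (front_derive t)). Qed.

Lemma geodesic_unit_speed t : dot (plus p (r t)) (plus p (r t)) = 1.
Proof.
destruct Hgeo as [_ H]; destruct (H t) as (_ & _ & _ & _ & E).
rewrite velocity_eq in E; rewrite <- vnorm_sqr, E; ring.
Qed.

Lemma geodesic_frame_vector_unit t : dot (v t) (v t) = 1.
Proof.
destruct Hgeo as [H _]; destruct (H t) as [E _]; rewrite <- vnorm_sqr, E; ring.
Qed.

Lemma r_dot_velocity t : dot (r t) (plus (r t) p) = 1 - s t.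
Proof.
unfold s; generalize (geodesic_unit_speed t); dot_expand.
rewrite (dot_comm p (r t)); lra.
Qed.

Lemma par_p_eq : par_p a b = q.
Proof.
unfold par_p; rewrite Ha; replace (q ^ 2 - b ^ 2 + b ^ 2) with (q ^ 2) by ring.
apply sqrt_pow2, sqrt_pos.
Qed.

Lemma ab_pos : 0 < a ^ 2 + b ^ 2.
Proof. rewrite Ha; generalize (pow_lt _ 2 (vnorm_p_pos p Hp)); lra. Qed.

Lemma r_norm t : dot (r t) (r t) = 1 + q ^ 2 - 2 * s t.
Proof.
rewrite vnorm_sqr; unfold s; generalize (geodesic_unit_speed t); dot_expand.
rewrite (dot_comm p (r t)); lra.
Qed.

Lemma curvature_sqr t : curvature x t ^ 2 = c t ^ 2 * dot (r t) (r t) + (1 - s t) ^ 2.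
Proof.
unfold curvature; rewrite vnorm_sqr.
assert (Dr := r_derive t); assert (E0 := r_orthogonal t).
assert (E : vderive (vderive x) t = minus (scal (c t) (r t)) (scal (1 - s t) (v t))).
{ apply vderive_eq.
  apply (is_derive_ext (fun t => plus p (r t))); [intro u; now rewrite velocity_eq|].
  rewrite <- r_dot_velocity; unfold c.
  rewrite <- (plus_zero_l (minus _ _)).
  apply (is_derive_plus (fun _ => p) r); [apply (is_derive_const p t)|exact Dr]. }
rewrite E; dot_expand; rewrite (dot_comm (v t) (r t)), E0, geodesic_frame_vector_unit; ring.
Qed.

(** Otherwise the velocity is the constant [p]. *)
Lemma r_not_identically_zero : ~ forall t, dot (r t) (r t) = 0.
Proof.
intro H; apply Hnonlin; exists (x 0), p; intro t; exists t.
assert (Hx : forall e, dot (x t) e = dot (x 0) e + t * dot p e).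
{ intro e.
  assert (D1 : forall u, is_derive (fun u => dot (x u) e) u (dot p e)).
  { intro u; replace (dot p e) with (dot (plus p (r u)) e).
    - apply is_derive_dot, front_derive.
    - rewrite (dot_self_zero _ (H u)), dot_plus_l; destruct e as [[? ?] ?]; simpl; ring. }
  assert (D2 : forall u, is_derive (fun u => u * dot p e) u (dot p e)) by (intro u; auto_derive; [exact I|ring]).
  generalize (increment_eq _ _ _ D1 D2 0 t); simpl; lra. }
apply minus_zero_eq, dot_self_zero.
set (d := minus (x t) (plus (x 0) (scal t p))).
unfold d at 1; dot_expand; rewrite Hx; ring.
Qed.

Section InFrame.
Variables (O e1 : vec3).
Hypothesis HO : on_line (axis_point x y p) p O.
Hypothesis He1 : vnorm e1 = 1.
Hypothesis He1p : dot e1 p = 0.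

Notation e3 := (axis_unit p).
Notation e2 := (normal_unit p e1).

Definition planar_x (t : R) : R := dot (minus (x t) O) e1.
Definition planar_y (t : R) : R := dot (minus (x t) O) e2.
Definition axial_z (t : R) : R := dot (minus (x t) O) e3.

Lemma dot_p (u : vec3) : dot u p = q * dot u e3.
Proof. rewrite (p_axis_unit p Hp) at 1; now rewrite dot_scal_r. Qed.

Lemma coordinate_derive (e : vec3) t :
  is_derive (fun t => dot (minus (x t) O) e) t (dot (plus p (r t)) e).
Proof.
apply (is_derive_ext (fun t => dot (x t) e - dot O e)); [intro u; now rewrite dot_minus_l|].
rewrite <- (Rminus_0_r (dot (plus p (r t)) e)).
apply (is_derive_minus (fun t => dot (x t) e) (fun _ => dot O e));
  [apply is_derive_dot, front_derive|apply (is_derive_const (dot O e) t)].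
Qed.

Lemma axial_z_derive t : is_derive axial_z t (s t / q).
Proof.
replace (s t / q) with (dot (plus p (r t)) e3); [apply coordinate_derive|].
assert (Hq := vnorm_p_pos p Hp); unfold s; rewrite dot_p; field; lra.
Qed.

Lemma on_axis_coordinates : dot O e1 = dot (axis_point x y p) e1 /\ dot O e2 = dot (axis_point x y p) e2.
Proof.
destruct HO as [l ->].
destruct (frame_p p e1 Hp He1 He1p) as (E1 & E2 & _).
split; dot_expand; rewrite ?E1, ?E2; ring.
Qed.

Lemma geodesic_planar_motion :
  planar_motion q a b planar_x planar_y (fun t => dot (r t) e1) (fun t => dot (r t) e2) s c
  /\ (forall t, is_derive c t (s t - c t ^ 2))
  /\ (forall t, c t ^ 2 * (1 + q ^ 2 - 2 * s t) = a ^ 2 - s t ^ 2).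
Proof.
assert (Hq := vnorm_p_pos p Hp).
destruct (frame_p p e1 Hp He1 He1p) as (P1 & P2 & P3).
assert (Hs : forall t, s t = q * (q + dot (r t) e3)).
{ intro t; unfold s; now rewrite dot_p, dot_plus_l, P3. }
assert (Hc : forall t, c t = q * dot (v t) e3) by (intro t; apply dot_p).
assert (Dv : forall e t, is_derive (fun t => dot (v t) e) t
   (dot p e + dot (r t) e - c t * dot (v t) e)).
{ intros e t; rewrite <- dot_plus_l. unfold c; rewrite <- dot_scal_l, <- dot_minus_l.
  apply is_derive_dot, frame_vector_derive. }
assert (Dr : forall e t, is_derive (fun t => dot (r t) e) t
   (c t * dot (r t) e - (1 - s t) * dot (v t) e)).
{ intros e t; rewrite <- r_dot_velocity; unfold c; rewrite <- !dot_scal_l, <- dot_minus_l.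
  apply is_derive_dot, r_derive. }
assert (Dv1 := Dv e1); assert (Dv2 := Dv e2); assert (Dv3 := Dv e3).
rewrite P1 in Dv1; rewrite P2 in Dv2; rewrite P3 in Dv3.
assert (Dv1' : forall t, is_derive (fun t => dot (v t) e1) t (dot (r t) e1 - c t * dot (v t) e1)).
{ intro t; generalize (Dv1 t); now rewrite Rplus_0_l. }
assert (Dv2' : forall t, is_derive (fun t => dot (v t) e2) t (dot (r t) e2 - c t * dot (v t) e2)).
{ intro t; generalize (Dv2 t); now rewrite Rplus_0_l. }
assert (Nv : forall t, dot (v t) e1 * dot (v t) e1 + dot (v t) e2 * dot (v t) e2
    + dot (v t) e3 * dot (v t) e3 = 1).
{ intro t; rewrite <- (frame_dot p e1 Hp He1 He1p); apply geodesic_frame_vector_unit. }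
assert (Nrv : forall t, dot (r t) e1 * dot (v t) e1 + dot (r t) e2 * dot (v t) e2
    + dot (r t) e3 * dot (v t) e3 = 0).
{ intro t; rewrite <- (frame_dot p e1 Hp He1 He1p); apply r_orthogonal. }
assert (Nx : forall t, dot (r t) e1 * dot (r t) e1 + dot (r t) e2 * dot (r t) e2
    + (q + dot (r t) e3) * (q + dot (r t) e3) = 1).
{ intro t; rewrite <- (geodesic_unit_speed t), (frame_dot p e1 Hp He1 He1p (plus p (r t))).
  dot_expand; rewrite P1, P2, P3; ring. }
assert (B0 : b = q * (dot (v 0) e1 * dot (r 0) e2 - dot (v 0) e2 * dot (r 0) e1)).
{ rewrite Hb; unfold geodesic_b; rewrite velocity_eq, dot_comm, dot_p.
  rewrite (proj2 (proj2 (frame_cross_coords p e1 Hp He1 He1p _ _))).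
  dot_expand; rewrite P1, P2; ring. }
assert (PM := frame_planar_motion q a b _ _ _ _ _ _ s c Hs Hc Hq Dv1' Dv2' Dv3
   (Dr e1) (Dr e2) (Dr e3) Nv Nrv Nx B0 Ha).
split; [|split].
- (* the axis point is placed so that these formulas hold at time 0, and velocities agree *)
  assert (EA : forall e, dot (minus (x 0) (axis_point x y p)) e = dot (v 0) e
     - / dot p p * dot (cross (cross (plus p (r 0)) (v 0)) p) e).
  { intro e; unfold axis_point, frame_vector; rewrite velocity_eq; dot_expand; ring. }
  assert (EX : forall t, (dot (r t) e1 * dot (v t) e3 - dot (r t) e3 * dot (v t) e1) / q = planar_x t).
  { intro t.
    assert (D : forall t, is_derive planar_x t (dot (r t) e1)).
    { intro u; generalize (coordinate_derive e1 u); now rewrite dot_plus_l, P1, Rplus_0_l. }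
    generalize (increment_eq _ _ _ (pm_X _ _ _ _ _ _ _ _ _ PM) D 0 t); cbv beta; intro I.
    assert (E0 : planar_x 0 = (dot (r 0) e1 * dot (v 0) e3 - dot (r 0) e3 * dot (v 0) e1) / q).
    { unfold planar_x; rewrite dot_minus_l, (proj1 on_axis_coordinates), <- dot_minus_l, EA.
      rewrite (proj1 (frame_cross_coords p e1 Hp He1 He1p _ _)).
      rewrite (proj1 (proj2 (frame_cross_coords p e1 Hp He1 He1p _ _))).
      dot_expand; rewrite <- vnorm_sqr, P1, P2, P3; field; lra. }
    lra. }
  assert (EY : forall t, (dot (r t) e2 * dot (v t) e3 - dot (r t) e3 * dot (v t) e2) / q = planar_y t).
  { intro t.
    assert (D : forall t, is_derive planar_y t (dot (r t) e2)).
    { intro u; generalize (coordinate_derive e2 u); now rewrite dot_plus_l, P2, Rplus_0_l. }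
    generalize (increment_eq _ _ _ (pm_Y _ _ _ _ _ _ _ _ _ PM) D 0 t); cbv beta; intro I.
    assert (E0 : planar_y 0 = (dot (r 0) e2 * dot (v 0) e3 - dot (r 0) e3 * dot (v 0) e2) / q).
    { unfold planar_y; rewrite dot_minus_l, (proj2 on_axis_coordinates), <- dot_minus_l, EA.
      rewrite (proj1 (proj2 (frame_cross_coords p e1 Hp He1 He1p _ _))).
      rewrite (proj1 (frame_cross_coords p e1 Hp He1 He1p _ _)).
      dot_expand; rewrite <- vnorm_sqr, P1, P2, P3; field; lra. }
    lra. }
  destruct PM as [M1 M2 M3 M4 M5 M6 M7 M8]; split; intro t; rewrite <- ?EX, <- ?EY; auto.
  + now apply (is_derive_ext _ planar_x _ _ EX).
  + now apply (is_derive_ext _ planar_y _ _ EY).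
- now apply frame_c_derive with (v3 := fun t => dot (v t) e3) (r3 := fun t => dot (r t) e3) (q := q).
- now apply (frame_energy q a b _ _ _ _ _ _ s c Hs Hc Dv1' Dv2' (Dr e1) (Dr e2) Nv Nrv Nx B0 Ha).
Qed.

End InFrame.

Lemma s_formula t : s t = - a + 2 * a * sn2 a b t.
Proof.
destruct (exists_unit_normal p Hp) as (e1 & He1 & He1p).
assert (HO : on_line (axis_point x y p) p (axis_point x y p)).
{ apply on_line_refl. }
destruct (geodesic_planar_motion _ e1 HO He1 He1p) as (PM & Dc & En).
assert (Eq : q ^ 2 = a ^ 2 + b ^ 2) by lra.
assert (Hs := pm_s _ _ _ _ _ _ _ _ _ PM); cbv beta in Hs.
assert (Rn : forall t, dot (r t) (r t) = 1 + (a ^ 2 + b ^ 2) - 2 * s t).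
{ intro u; rewrite r_norm, Eq; reflexivity. }
rewrite Eq in Hs, En.
apply (axial_velocity_sn a b s c); auto.
- apply ab_pos.
- intro u; rewrite <- Rn; apply dot_self_nonneg.
- intro u; rewrite <- Eq, vnorm_sqr; unfold c.
  generalize (dot_self_nonneg (cross (v u) p)).
  rewrite dot_cross_cross, geodesic_frame_vector_unit, (dot_comm p (v u)); lra.
- intro H; apply r_not_identically_zero; intro u; rewrite Rn; apply H.
- (* the squared curvature is 1 + a^2 - 2 s *)
  intro u; generalize (Hmax u); rewrite !curvature_sqr, !Rn, !En; lra.
Qed.

Lemma geodesic_in_cylinder (O e1 : vec3) :
  cyl_frame (axis_point x y p) p O e1 ->
  exists U V s c : R -> R,
    planar_motion q a b (planar_x O e1) (planar_y O e1) U V s c /\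
    (forall t, s t = - a + 2 * a * sn2 a b t) /\
    (forall t, is_derive (axial_z O) t (s t / q)).
Proof.
intros (HO & He1 & He1p).
do 2 eexists; exists s, c; split; [apply geodesic_planar_motion; assumption|split].
- exact s_formula.
- intro t; apply axial_z_derive.
Qed.

End Geodesic.

(** * Screw motions and rigidity *)

Section Screw.
Variables p e1 : vec3.
Hypothesis Hp : p <> (0, 0, 0).
Hypothesis He1 : vnorm e1 = 1.
Hypothesis He1p : dot e1 p = 0.
Variable O : vec3.

Notation e3 := (axis_unit p).
Notation e2 := (normal_unit p e1).

Lemma frame_combination (x y z : R) (u : vec3) :
  u = plus O (plus (plus (scal x e1) (scal y e2)) (scal z e3)) <->
  dot (minus u O) e1 = x /\ dot (minus u O) e2 = y /\ dot (minus u O) e3 = z.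
Proof.
destruct (frame_dots p e1 Hp He1 He1p) as (E11 & E22 & E33 & E12 & E13 & E23).
assert (E : forall e, dot (plus O (plus (plus (scal x e1) (scal y e2)) (scal z e3))) e
  = dot O e + x * dot e1 e + y * dot e2 e + z * dot e3 e) by (intro; dot_expand; ring).
split.
- intros ->; rewrite !dot_minus_l, !E, (dot_comm e2 e1), (dot_comm e3 e1), (dot_comm e3 e2),
    E11, E22, E33, E12, E13, E23; repeat split; ring.
- rewrite !dot_minus_l; intros (H1 & H2 & H3).
  apply (frame_ext p e1 Hp He1 He1p); rewrite E, ?(dot_comm e2 e1), ?(dot_comm e3 e1),
    ?(dot_comm e3 e2), ?E11, ?E22, ?E33, ?E12, ?E13, ?E23; lra.
Qed.

Lemma on_axis_of_coords (u : vec3) :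
  dot (minus u O) e1 = 0 -> dot (minus u O) e2 = 0 -> on_line O p u.
Proof.
destruct (frame_p p e1 Hp He1 He1p) as (P1 & P2 & P3).
assert (Hq := vnorm_p_pos p Hp).
rewrite !dot_minus_l; intros H1 H2.
exists (dot (minus u O) e3 / vnorm p).
apply (frame_ext p e1 Hp He1 He1p); rewrite dot_plus_l, dot_scal_l, ?P1, ?P2, ?P3; try lra.
rewrite dot_minus_l; field; lra.
Qed.

Lemma cyl_coords_iff (u : vec3) (rho theta z : R) :
  cyl_coords p O e1 u rho theta z <->
  0 <= rho /\ dot (minus u O) e1 = rho * cos theta /\
  dot (minus u O) e2 = rho * sin theta /\ dot (minus u O) e3 = z.
Proof.
unfold cyl_coords; fold (axis_unit p); fold (normal_unit p e1).
rewrite frame_combination; tauto.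
Qed.

(** In the frame at [O]: rotation by [phi] about the axis and translation by [dz]
    along it. *)
Definition screw (phi dz : R) (u : vec3) : vec3 :=
  let x := dot (minus u O) e1 in
  let y := dot (minus u O) e2 in
  plus O (plus (plus (scal (cos phi * x - sin phi * y) e1)
                     (scal (sin phi * x + cos phi * y) e2))
               (scal (dot (minus u O) e3 + dz) e3)).

Lemma screw_coords phi dz u :
  dot (minus (screw phi dz u) O) e1 =
    cos phi * dot (minus u O) e1 - sin phi * dot (minus u O) e2 /\
  dot (minus (screw phi dz u) O) e2 =
    sin phi * dot (minus u O) e1 + cos phi * dot (minus u O) e2 /\
  dot (minus (screw phi dz u) O) e3 = dot (minus u O) e3 + dz.
Proof. now apply frame_combination. Qed.

Lemma screw_eq phi dz u w :
  dot (minus w O) e1 = cos phi * dot (minus u O) e1 - sin phi * dot (minus u O) e2 ->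
  dot (minus w O) e2 = sin phi * dot (minus u O) e1 + cos phi * dot (minus u O) e2 ->
  dot (minus w O) e3 = dot (minus u O) e3 + dz ->
  w = screw phi dz u.
Proof. intros; now apply frame_combination. Qed.

Lemma screw_is_screw_motion phi dz : screw_motion p O e1 phi dz (screw phi dz).
Proof.
intros u rho theta z; rewrite !cyl_coords_iff.
destruct (screw_coords phi dz u) as (-> & -> & ->).
intros (Hrho & -> & -> & ->); rewrite cos_plus, sin_plus; repeat split; try ring; exact Hrho.
Qed.

Lemma screw_difference phi dz u w :
  let d := minus u w in let d' := minus (screw phi dz u) (screw phi dz w) in
  dot d' e1 = cos phi * dot d e1 - sin phi * dot d e2 /\
  dot d' e2 = sin phi * dot d e1 + cos phi * dot d e2 /\
  dot d' e3 = dot d e3.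
Proof.
intros d d'; unfold d, d'; clear d d'.
destruct (screw_coords phi dz u) as (U1 & U2 & U3).
destruct (screw_coords phi dz w) as (W1 & W2 & W3).
rewrite !dot_minus_l in *; lra.
Qed.

Lemma screw_orientation_preserving phi dz : orientation_preserving_isometry (screw phi dz).
Proof.
assert (SC : cos phi * cos phi = 1 - sin phi * sin phi).
{ generalize (sin2_cos2 phi); unfold Rsqr; lra. }
split.
- intros u w; unfold vnorm; f_equal.
  rewrite (frame_dot p e1 Hp He1 He1p (minus (screw phi dz u) (screw phi dz w))
             (minus (screw phi dz u) (screw phi dz w))),
          (frame_dot p e1 Hp He1 He1p (minus u w) (minus u w)).
  destruct (screw_difference phi dz u w) as (-> & -> & ->); ring [SC].
- intros u u1 u2 u3; unfold triple.
  rewrite (frame_dot p e1 Hp He1 He1p (minus u1 u) (cross _ _)),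
    (frame_dot p e1 Hp He1 He1p (minus (screw phi dz u1) (screw phi dz u)) (cross _ _)).
  assert (F := frame_cross_coords p e1 Hp He1 He1p).
  destruct (F (minus (screw phi dz u2) (screw phi dz u)) (minus (screw phi dz u3) (screw phi dz u)))
    as (-> & -> & ->).
  destruct (F (minus u2 u) (minus u3 u)) as (-> & -> & ->).
  destruct (screw_difference phi dz u1 u) as (-> & -> & ->).
  destruct (screw_difference phi dz u2 u) as (-> & -> & ->).
  destruct (screw_difference phi dz u3 u) as (-> & -> & ->).
  ring [SC].
Qed.

End Screw.

(** Polarization: the product is a combination of squared distances. *)
Lemma isometry_dot (M : vec3 -> vec3) (u v w : vec3) : isometry M ->
  dot (minus (M u) (M w)) (minus (M v) (M w)) = dot (minus u w) (minus v w).
Proof.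
intro H.
assert (N : forall q q', dot (minus (M q) (M q')) (minus (M q) (M q')) = dot (minus q q') (minus q q')).
{ intros q q'; rewrite <- !vnorm_sqr; now rewrite H. }
assert (P : forall a b c : vec3, dot (minus a c) (minus b c) =
  (dot (minus a c) (minus a c) + dot (minus b c) (minus b c) - dot (minus a b) (minus a b)) / 2).
{ intros a b c; dot_expand; rewrite (dot_comm b a), (dot_comm c a), (dot_comm c b); field. }
rewrite P, !N; symmetry; apply P.
Qed.

(** An isometry preserves the products of [u - u0] with [u1 - u0], [u2 - u0], and,
    with orientation, the triple product; these determine [u - u0]. *)
Lemma isometry_determined (M M' : vec3 -> vec3) (u0 u1 u2 : vec3) :
  orientation_preserving_isometry M -> orientation_preserving_isometry M' ->
  M u0 = M' u0 -> M u1 = M' u1 -> M u2 = M' u2 ->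
  cross (minus u1 u0) (minus u2 u0) <> (0, 0, 0) ->
  forall u, M u = M' u.
Proof.
intros [HM TM] [HM' TM'] E0 E1 E2 Hc u.
apply minus_zero_eq.
assert (S : minus (M u) (M' u) = minus (minus (M u) (M u0)) (minus (M' u) (M' u0))).
{ rewrite E0; destruct (M u) as [[? ?] ?], (M' u) as [[? ?] ?], (M' u0) as [[? ?] ?];
  rewrite !minus_coords; vec_eq; ring. }
apply (orthogonal_to_basis _ (minus (M u1) (M u0)) (minus (M u2) (M u0))).
- rewrite dot_cross_cross, !isometry_dot by exact HM.
  rewrite <- dot_cross_cross; intro H; apply Hc, dot_self_zero, H.
- rewrite S, dot_minus_l, isometry_dot by exact HM.
  rewrite E1, E0, isometry_dot by exact HM'; ring.
- rewrite S, dot_minus_l, isometry_dot by exact HM.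
  rewrite E2, E0, isometry_dot by exact HM'; ring.
- rewrite S; unfold triple; rewrite dot_minus_l.
  change (triple (minus (M u) (M u0)) (minus (M u1) (M u0)) (minus (M u2) (M u0))
    - triple (minus (M' u) (M' u0)) (minus (M u1) (M u0)) (minus (M u2) (M u0)) = 0).
  rewrite TM, E0, E1, E2, TM'; ring.
Qed.

Lemma parallel_on_line (c d u : vec3) :
  d <> (0, 0, 0) -> cross d (minus u c) = (0, 0, 0) -> on_line c d u.
Proof.
intros Hd H; exists (dot d (minus u c) / dot d d).
assert (Hdd : dot d d <> 0) by (intro E; apply Hd, dot_self_zero, E).
assert (E := cross_cross d d (minus u c)); rewrite H in E.
assert (E' : forall w, dot d d * dot (minus u c) w = dot d (minus u c) * dot d w).
{ intro w; assert (Z : dot (cross d (0, 0, 0)) w = 0) by vec.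
  rewrite E, dot_minus_l, !dot_scal_l in Z; lra. }
apply minus_zero_eq, dot_self_zero.
set (m := minus u (plus c (scal (dot d (minus u c) / dot d d) d))).
assert (Em : forall w, dot m w = dot (minus u c) w - dot d (minus u c) / dot d d * dot d w).
{ intro w; unfold m; rewrite dot_minus_l, dot_plus_l, dot_scal_l, (dot_minus_l u c w); ring. }
rewrite Em; apply (Rmult_eq_reg_l (dot d d)); [|exact Hdd].
rewrite Rmult_minus_distr_l, E'; field; exact Hdd.
Qed.

Lemma nonlinear_noncollinear (x : R -> vec3) : ~ linear_track x ->
  exists t1 t2, cross (minus (x t1) (x 0)) (minus (x t2) (x 0)) <> (0, 0, 0).
Proof.
intro H; apply NNPP; intro N; apply H.
destruct (classic (exists t1, minus (x t1) (x 0) <> (0, 0, 0))) as [[t1 Ht1]|Hc].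
- exists (x 0), (minus (x t1) (x 0)); intro t.
  apply parallel_on_line; [exact Ht1|].
  apply NNPP; intro Hne; apply N; now exists t1, t.
- exists (x 0), (0, 0, 0); intro t; exists 0.
  assert (E : minus (x t) (x 0) = (0, 0, 0)) by (apply NNPP; intro Hne; apply Hc; now exists t).
  rewrite (minus_zero_eq _ _ E); destruct (x 0) as [[? ?] ?].
  rewrite scal_coords, plus_coords; vec_eq; ring.
Qed.

Lemma monodromy_unique (x : R -> vec3) (T : R) (M M' : vec3 -> vec3) :
  ~ linear_track x -> is_monodromy x T M -> is_monodromy x T M' -> forall u, M u = M' u.
Proof.
intros Hx [HM EM] [HM' EM'].
destruct (nonlinear_noncollinear x Hx) as (t1 & t2 & H).
apply (isometry_determined M M' (x 0) (x t1) (x t2)); auto; rewrite <- EM; apply EM'.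
Qed.

Lemma screw_motion_ext (p O e1 : vec3) (phi dz : R) (M M' : vec3 -> vec3) :
  (forall u, M u = M' u) -> screw_motion p O e1 phi dz M' -> screw_motion p O e1 phi dz M.
Proof. intros E H u rho theta z Hc; rewrite E; now apply H. Qed.

(** * The solution and its monodromy *)

Section Solution.
Variables (a b : R) (X Y U V s c : R -> R).
Hypothesis Ha : 0 <= a.
Hypothesis Hab : 0 < a ^ 2 + b ^ 2.
Hypothesis PM : planar_motion (par_p a b) a b X Y U V s c.
Hypothesis Hs : forall t, s t = - a + 2 * a * sn2 a b t.

Notation q := (par_p a b).

Lemma solution_norm t : q ^ 2 * (X t ^ 2 + Y t ^ 2) = par_A a b - 4 * a * sn2 a b t.
Proof.
assert (Hq := par_p_pos a b Hab).
rewrite (pm_norm _ _ _ _ _ _ _ _ _ PM), Hs; unfold par_A; field; lra.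
Qed.

Lemma solution_radius (rho t : R) :
  0 <= rho -> rho ^ 2 = X t ^ 2 + Y t ^ 2 -> rho = sol_r a b t.
Proof.
intros Hrho E; assert (Hq := par_p_pos a b Hab).
unfold sol_r; fold (sn2 a b t); rewrite <- solution_norm, <- E, <- Rpow_mult_distr.
rewrite sqrt_pow2 by nra; field; lra.
Qed.

Lemma solution_angle_rate t : 0 < X t ^ 2 + Y t ^ 2 ->
  b / (2 * q) * (1 + par_B a b / (1 - par_n a b * sn2 a b t)) =
  (X t * V t - Y t * U t) / (X t ^ 2 + Y t ^ 2).
Proof.
intro H; symmetry; apply (sol_theta_rate a b Ha Hab (s t)); trivial.
- apply (pm_norm _ _ _ _ _ _ _ _ _ PM).
- apply (pm_angular _ _ _ _ _ _ _ _ _ PM).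
Qed.

Lemma solution_angle (rho theta : R -> R) (t1 t2 : R) :
  (forall t, X t = rho t * cos (theta t)) -> (forall t, Y t = rho t * sin (theta t)) ->
  angle_determination rho theta t1 t2 ->
  theta t2 - theta t1 = sol_theta a b t2 - sol_theta a b t1.
Proof.
intros EX EY.
exact (polar_angle_increment X Y U V _ _ rho theta t1 t2
  (pm_X _ _ _ _ _ _ _ _ _ PM) (pm_Y _ _ _ _ _ _ _ _ _ PM)
  (sol_theta_derive a b Ha Hab) solution_angle_rate EX EY).
Qed.

Lemma solution_start : 0 < X 0 ^ 2 + Y 0 ^ 2.
Proof.
assert (Hq := par_p_pos a b Hab).
apply (Rmult_lt_reg_l (q ^ 2)); [now apply pow_lt|].
rewrite Rmult_0_r, solution_norm; unfold sn2, jacobi_sn.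
rewrite Rmult_0_r, (proj1 (am_solution _ (par_k_bounds a b Ha))), sin_0.
generalize (par_A_pos a b Ha Hab); lra.
Qed.

Hypothesis Hk : (a, b) <> (1, 0).
Notation T := (par_T a b).

Lemma solution_s_bounds t : - a <= s t <= a.
Proof. rewrite Hs; generalize (sn2_bounds a b Ha t); nra. Qed.

Lemma solution_s_periodic t : s (t + T) = s t.
Proof. rewrite !Hs; now rewrite (proj2 (sn2_even_periodic_T a b Ha Hab Hk t)). Qed.

Lemma solution_rotation :
  exists phi, forall t, X (t + T) = cos phi * X t - sin phi * Y t /\
                        Y (t + T) = sin phi * X t + cos phi * Y t.
Proof.
apply (planar_motion_rotation q a b T X Y U V s c PM (par_p_pos a b Hab)
  solution_s_bounds solution_s_periodic solution_start).
Qed.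

(** Off the axis the polar angle over one period is given by [polar_transport],
    which fixes the angle of the rotation modulo [2 PI]. *)
Lemma solution_rotation_off_axis :
  (forall t, 0 < X t ^ 2 + Y t ^ 2) ->
  let phi := delta_theta a b in
  forall t, X (t + T) = cos phi * X t - sin phi * Y t /\
            Y (t + T) = sin phi * X t + cos phi * Y t.
Proof.
intros Hoff phi.
assert (Hq := par_p_pos a b Hab).
destruct (polar_transport X Y U V _ _ 0 T
  (pm_X _ _ _ _ _ _ _ _ _ PM) (pm_Y _ _ _ _ _ _ _ _ _ PM)
  (sol_theta_derive a b Ha Hab)
  (fun u _ => conj (Hoff u) (solution_angle_rate u (Hoff u)))) as [TX TY].
assert (Ed : sol_theta a b T - sol_theta a b 0 = phi).
{ rewrite <- (Rplus_0_l T) at 1; now apply sol_theta_increment. }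
assert (N : X T ^ 2 + Y T ^ 2 = X 0 ^ 2 + Y 0 ^ 2).
{ apply (Rmult_eq_reg_l (q ^ 2)); [|apply pow_nonzero; lra].
  rewrite !(pm_norm _ _ _ _ _ _ _ _ _ PM), <- (solution_s_periodic 0), Rplus_0_l; reflexivity. }
rewrite Ed, N in TX, TY.
assert (P := sqrt_lt_R0 _ (Hoff 0)).
set (n := sqrt (X 0 ^ 2 + Y 0 ^ 2)) in *.
apply (planar_motion_period q a b T X Y U V s c PM Hq
  solution_s_bounds solution_s_periodic solution_start).
- transitivity (X T / n * n); [field; lra|rewrite TX; field; lra].
- transitivity (Y T / n * n); [field; lra|rewrite TY; field; lra].
Qed.

End Solution.

Theorem propositionA3
  (x y : R -> vec3) (p : vec3) (r : R -> vec3) (a b : R)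
  (Hgeo : bicycling_geodesic x y p r)
  (Hnonlin : ~ linear_track x)
  (Hp : p <> (0, 0, 0))
  (Hb : b = geodesic_b x y p)
  (Hb0 : 0 <= b)
  (Ha : a ^ 2 = vnorm p ^ 2 - b ^ 2)
  (Ha0 : 0 <= a)
  (Hmax : forall t, curvature x t ^ 2 <= curvature x 0 ^ 2) :
  (forall (O e1 : vec3) (rho theta z : R -> R),
     cyl_frame (axis_point x y p) p O e1 ->
     cyl_coords_of_curve p O e1 x rho theta z ->
     theta 0 = 0 -> z 0 = 0 ->
     forall t,
       rho t = sol_r a b t /\
       (angle_determination rho theta 0 t -> theta t = sol_theta a b t) /\
       z t = sol_z a b t)
  /\
  ((a, b) <> (1, 0) ->
   (exists M, is_monodromy x (par_T a b) M) /\
   forall O e1 : vec3,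
     cyl_frame (axis_point x y p) p O e1 ->
     (forall M, is_monodromy x (par_T a b) M ->
        (exists phi, screw_motion p O e1 phi (delta_z a b) M) /\
        ((forall t, ~ on_line O p (x t)) ->
         screw_motion p O e1 (delta_theta a b) (delta_z a b) M)) /\
     (forall rho theta z : R -> R,
        cyl_coords_of_curve p O e1 x rho theta z ->
        forall t,
          (angle_determination rho theta t (t + par_T a b) ->
           theta (t + par_T a b) - theta t = delta_theta a b) /\
          z (t + par_T a b) - z t = delta_z a b)).
Proof.
assert (Hab := ab_pos p a b Hp Ha).
assert (Eq := par_p_eq p a b Ha).
assert (cyl : forall O e1, cyl_frame (axis_point x y p) p O e1 ->
  exists U V s c : R -> R,
    planar_motion (par_p a b) a b (planar_x x O e1) (planar_y x p O e1) U V s c /\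
    (forall t, s t = - a + 2 * a * sn2 a b t) /\
    forall t1 t2, axial_z x p O t2 - axial_z x p O t1 = sol_z a b t2 - sol_z a b t1).
{ intros O e1 HF.
  destruct (geodesic_in_cylinder x y p r a b Hgeo Hnonlin Hp Hb Ha Ha0 Hmax O e1 HF)
    as (U & V & s & c & PM & Hs & Hz).
  exists U, V, s, c; rewrite Eq; split; [exact PM|split; [exact Hs|]].
  apply (increment_eq _ _ (fun t => s t / vnorm p)); [exact Hz|].
  intro t; rewrite <- Eq, Hs; now apply sol_z_derive. }
assert (coords : forall O e1 rho theta z, cyl_frame (axis_point x y p) p O e1 ->
  cyl_coords_of_curve p O e1 x rho theta z -> forall t,
    0 <= rho t /\ planar_x x O e1 t = rho t * cos (theta t) /\
    planar_y x p O e1 t = rho t * sin (theta t) /\ axial_z x p O t = z t).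
{ intros O e1 rho theta z (_ & He1 & He1p) Hcyl t.
  now apply (cyl_coords_iff p e1 Hp He1 He1p), Hcyl. }
split.
- intros O e1 rho theta z HF Hcyl Hth0 Hz0 t.
  destruct (cyl O e1 HF) as (U & V & s & c & PM & Hs & Hz).
  assert (HC := coords _ _ _ _ _ HF Hcyl).
  split; [|split].
  + destruct (HC t) as (Hrho & EX & EY & _).
    apply (solution_radius a b _ _ _ _ _ _ Hab PM Hs (rho t) t); [exact Hrho|].
    rewrite EX, EY; generalize (sin2_cos2 (theta t)); unfold Rsqr; intro SC.
    transitivity (rho t ^ 2 * (sin (theta t) * sin (theta t) + cos (theta t) * cos (theta t)));
      [rewrite SC|]; ring.
  + intro Hang.
    generalize (solution_angle a b _ _ _ _ _ _ Ha0 Hab PM Hs rho theta 0 t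
      (fun u => proj1 (proj2 (HC u))) (fun u => proj1 (proj2 (proj2 (HC u)))) Hang).
    rewrite Hth0, sol_theta_0; lra.
  + generalize (Hz 0 t).
    rewrite (proj2 (proj2 (proj2 (HC 0)))), (proj2 (proj2 (proj2 (HC t)))), Hz0, sol_z_0; lra.
- intro Hk.
  assert (mono : forall O e1, cyl_frame (axis_point x y p) p O e1 -> forall phi,
    (forall t, planar_x x O e1 (t + par_T a b) = cos phi * planar_x x O e1 t - sin phi * planar_y x p O e1 t /\
               planar_y x p O e1 (t + par_T a b) = sin phi * planar_x x O e1 t + cos phi * planar_y x p O e1 t) ->
    is_monodromy x (par_T a b) (screw p e1 O phi (delta_z a b))).
  { intros O e1 HF phi Hphi.
    destruct (cyl O e1 HF) as (_ & _ & _ & _ & _ & _ & Hz).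
    destruct HF as (_ & He1 & He1p).
    split; [now apply screw_orientation_preserving|]; intro t.
    apply (screw_eq p e1 Hp He1 He1p); [apply Hphi|apply Hphi|].
    generalize (Hz t (t + par_T a b)); rewrite (sol_z_increment a b Ha0 Hab Hk).
    unfold axial_z; lra. }
  split.
  + destruct (exists_unit_normal p Hp) as (e1 & He1 & He1p).
    assert (HF : cyl_frame (axis_point x y p) p (axis_point x y p) e1)
      by (split; [apply on_line_refl|now split]).
    destruct (cyl _ _ HF) as (U & V & s & c & PM & Hs & _).
    destruct (solution_rotation a b _ _ _ _ _ _ Ha0 Hab PM Hs Hk) as [phi Hphi].
    eexists; exact (mono _ _ HF phi Hphi).
  + intros O e1 HF.
    assert (HF' := HF); destruct HF' as (_ & He1 & He1p).
    destruct (cyl O e1 HF) as (U & V & s & c & PM & Hs & Hz).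
    split.
    * intros M HM; split.
      -- destruct (solution_rotation a b _ _ _ _ _ _ Ha0 Hab PM Hs Hk) as [phi Hphi].
         exists phi; apply (screw_motion_ext _ _ _ _ _ M (screw p e1 O phi (delta_z a b))).
         ++ exact (monodromy_unique x _ _ _ Hnonlin HM (mono _ _ HF phi Hphi)).
         ++ now apply screw_is_screw_motion.
      -- intro Hoff.
         assert (Hpos : forall t, 0 < planar_x x O e1 t ^ 2 + planar_y x p O e1 t ^ 2).
         { intro t; destruct (Req_dec (planar_x x O e1 t ^ 2 + planar_y x p O e1 t ^ 2) 0) as [E|E];
             [exfalso|nra].
           apply (Hoff t), (on_axis_of_coords p e1 Hp He1 He1p).
           - change (planar_x x O e1 t = 0); nra.
           - change (planar_y x p O e1 t = 0); nra. }
         apply (screw_motion_ext _ _ _ _ _ M (screw p e1 O (delta_theta a b) (delta_z a b))).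
         ++ apply (monodromy_unique x _ _ _ Hnonlin HM), (mono _ _ HF).
            exact (solution_rotation_off_axis a b _ _ _ _ _ _ Ha0 Hab PM Hs Hk Hpos).
         ++ now apply screw_is_screw_motion.
    * intros rho theta z Hcyl t.
      assert (HC := coords _ _ _ _ _ HF Hcyl).
      split.
      -- intro Hang.
         rewrite (solution_angle a b _ _ _ _ _ _ Ha0 Hab PM Hs rho theta t (t + par_T a b)
           (fun u => proj1 (proj2 (HC u))) (fun u => proj1 (proj2 (proj2 (HC u)))) Hang).
         now apply sol_theta_increment.
      -- rewrite <- (proj2 (proj2 (proj2 (HC t)))), <- (proj2 (proj2 (proj2 (HC (t + par_T a b))))).
         rewrite Hz; now apply sol_z_increment.
Qed.
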